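(* For every $\mathbf{Top}$-graph $\Gamma$, the fundamental $\mathbf{Top}$-groupoid $\pi^{\tau}(\Gamma,\Gamma_0)$ is naturally isomorphic (as a $\mathbf{Top}$-groupoid) to the free $\mathbf{Top}$-groupoid $\mathscr F(\pi_0(\Gamma))$ on the path-component $\mathbf{Top}$-graph $\pi_0(\Gamma)$; the isomorphism is induced by sending the path component of an edge $e$ to the homotopy class of the canonical edge path $\alpha_e$.
   Context: A $\mathbf{Top}$-graph $\Gamma$: discrete vertex space $\Gamma_0$, edge space $\Gamma$, continuous $\partial_0,\partial_1:\Gamma\to\Gamma_0$; $\Gamma(x,y)=\partial_0^{-1}(x)\cap\partial_1^{-1}(y)$. Realization $|\Gamma|=\Gamma_0\sqcup(\Gamma\times[0,1])/((\alpha,i)\sim\partial_i(\alpha))$, topologized by the basis of vertex neighborhoods $B(x,r)$, $0<r<1$ (image of $(\partial_0^{-1}(x)\times[0,r))\cup(\partial_1^{-1}(x)\times(1-r,1])$) and edge neighborhoods (images of $U\times(a,b)$, $U$ open in some $\Gamma(x,y)$, $0<a<b<1$). For $e\in\Gamma(x,y)$, $\alpha_e(t)$ is the image of $(e,t)$. $\pi_0(\Gamma)$ is the $\mathbf{Top}$-graph with vertices $\Gamma_0$ and edge spaces $\pi_0(\Gamma(x,y))$ (path-component spaces, quotient topology). A $\mathbf{Top}$-groupoid is a groupoid with discrete object set, topologized hom-sets and continuous composition and inversion. The free $\mathbf{Top}$-groupoid $\mathscr F(\Delta)$ on a $\mathbf{Top}$-graph $\Delta$ is the $\mathbf{Top}$-groupoid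 with objects $\Delta_0$ and a $\mathbf{Top}$-graph morphism $\Delta\to\mathscr F(\Delta)$ through which every $\mathbf{Top}$-graph morphism into a $\mathbf{Top}$-groupoid factors uniquely by a hom-wise continuous functor. $\pi^{qtop}(\Gamma,\Gamma_0)$ is the fundamental groupoid of $|\Gamma|$ on the object set $\Gamma_0$ with each hom-set of homotopy classes of paths given the quotient topology of the compact-open path space; its composition is separately continuous and inversion continuous. The fundamental $\mathbf{Top}$-groupoid $\pi^\tau(\Gamma,\Gamma_0)$ is $\tau(\pi^{qtop}(\Gamma,\Gamma_0))$, where $\tau$ is the left adjoint (reflection) of the inclusion of $\mathbf{Top}$-groupoids into groupoids with topologized hom-sets, continuous inversion and separately continuous composition; $\tau$ does not change the underlying groupoid, and the identity $\pi^{qtop}\to\pi^\tau$ is continuous and universal for hom-wise continuous functors into $\mathbf{Top}$-groupoids. *)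

(* Defs.v *)
From HB Require Import structures.
From mathcomp Require Import all_boot all_order all_algebra.
From mathcomp Require Import all_classical reals topology normedtype.
Import numFieldNormedType.Exports.

Set Implicit Arguments.
Unset Strict Implicit.
Unset Printing Implicit Defensive.

Import Order.TTheory GRing.Theory Num.Theory.
Local Open Scope classical_set_scope.
Local Open Scope ring_scope.

(* Composition is written in diagrammatic order:
     tg_comp (a : x --> y) (b : y --> z) : x --> z
   (the order in which paths are concatenated).                        *)
Record TopGroupoid := {
  tg_ob : Type;
  tg_hom : tg_ob -> tg_ob -> topologicalType;
  tg_id : forall x, tg_hom x x;
  tg_comp : forall x y z, tg_hom x y -> tg_hom y z -> tg_hom x z;
  tg_inv : forall x y, tg_hom x y -> tg_hom y x;
  tg_assoc : forall x y z w (a : tg_hom x y) (b : tg_hom y z) (c : tg_hom z w),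
      tg_comp (tg_comp a b) c = tg_comp a (tg_comp b c);
  tg_id_l : forall x y (a : tg_hom x y), tg_comp (tg_id x) a = a;
  tg_id_r : forall x y (a : tg_hom x y), tg_comp a (tg_id y) = a;
  tg_inv_l : forall x y (a : tg_hom x y), tg_comp (tg_inv a) a = tg_id y;
  tg_inv_r : forall x y (a : tg_hom x y), tg_comp a (tg_inv a) = tg_id x;
  tg_comp_cont : forall x y z,
      continuous (fun p : tg_hom x y * tg_hom y z => tg_comp p.1 p.2);
  tg_inv_cont : forall x y, continuous (@tg_inv x y)
}.

Section TopGraph.
Variables (R : realType) (V : Type) (E : topologicalType) (d0 d1 : E -> V).

Definition unit_interval : Type := set_type (`[0, 1]%classic : set R).
HB.instance Definition _ := Topological.copy unit_interval (set_type (`[0, 1]%classic : set R)).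

Lemma in01_0 : (0 : R) \in (`[0, 1]%classic : set R).
Proof. by apply/mem_set; rewrite /= in_itv /= lexx ler01. Qed.
Lemma in01_1 : (1 : R) \in (`[0, 1]%classic : set R).
Proof. by apply/mem_set; rewrite /= in_itv /= lexx ler01. Qed.

Definition i0 : unit_interval := exist _ 0 in01_0.
Definition i1 : unit_interval := exist _ 1 in01_1.

(** clamp a real number into [0,1] (only used with arguments already in [0,1]) *)
Definition clampI (r : R) : unit_interval :=
  match pselect (r \in (`[0, 1]%classic : set R)) with
  | left h => exist _ r h
  | right _ => i0
  end.

Definition Gxy (x y : V) : Type := set_type [set e : E | d0 e = x /\ d1 e = y].
HB.instance Definition _ (x y : V) := Topological.copy (Gxy x y) (set_type [set e : E | d0 e = x /\ d1 e = y]).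

Definition path_comp x y (e : Gxy x y) : set (Gxy x y) :=
  [set e' | exists g : unit_interval -> Gxy x y,
      continuous g /\ g i0 = e /\ g i1 = e'].

Definition Pi0 (x y : V) : Type :=
  {A : set (Gxy x y) | exists e, A = path_comp e}.

Definition pi0_class x y (e : Gxy x y) : Pi0 x y :=
  exist _ (path_comp e) (ex_intro _ e erefl).

Definition pi0_open x y (U : set (Pi0 x y)) : Prop :=
  open (@pi0_class x y @^-1` U).

(* As a set, |Gamma| = Gamma_0 + Gamma x ]0,1[ : the points (alpha, 0) and
   (alpha, 1) are identified with the vertices d0 alpha and d1 alpha.        *)
Definition open01 : Type := set_type (`]0, 1[%classic : set R).

Definition realization : Type := (V + E * open01)%type.

HB.instance Definition _ := gen_eqMixin realization.
HB.instance Definition _ := gen_choiceMixin realization.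

Definition vertex_nbhd (B : set realization) : Prop :=
  exists (x : V) (r : R), 0 < r < 1 /\
    B = [set p | p = inl x \/
           exists (e : E) (t : open01), p = inr (e, t) /\
             ((d0 e = x /\ val t < r) \/ (d1 e = x /\ 1 - r < val t))].

Definition edge_nbhd (B : set realization) : Prop :=
  exists (x y : V) (U : set (Gxy x y)) (a b : R),
    open U /\ 0 < a /\ a < b /\ b < 1 /\
    B = [set p | exists (e : Gxy x y) (t : open01),
           p = inr (val e, t) /\ U e /\ a < val t < b].

Definition realization_basis : set (set realization) :=
  [set B | vertex_nbhd B \/ edge_nbhd B].

HB.instance Definition _ :=
  @isSubBaseTopological.Build realization (set realization)
    realization_basis id.

Definition alpha (e : E) (t : unit_interval) : realization :=
  match pselect (val t \in (`]0, 1[%classic : set R)) with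
  | left h => inr (e, exist _ (val t) h)
  | right _ => if val t == 0 then inl (d0 e) else inl (d1 e)
  end.

Definition vtx (x : V) : realization := inl x.

Definition is_path (x y : V) : set (@compact_open unit_interval realization) :=
  [set f | continuous (f : unit_interval -> realization) /\
           f i0 = vtx x /\ f i1 = vtx y].

Definition PathSpace (x y : V) : Type := set_type (is_path x y).
HB.instance Definition _ (x y : V) := Topological.copy (PathSpace x y) (set_type (is_path x y)).

Definition pval x y (p : PathSpace x y) : unit_interval -> realization :=
  set_val p.

Definition path_homotopic (x y : V) (f g : unit_interval -> realization) :=
  exists H : unit_interval * unit_interval -> realization,
    continuous H /\
    (forall s, H (s, i0) = f s) /\ (forall s, H (s, i1) = g s) /\
    (forall t, H (i0, t) = vtx x) /\ (forall t, H (i1, t) = vtx y).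

Definition hclass x y (p : PathSpace x y) : set (PathSpace x y) :=
  [set q | path_homotopic x y (pval p) (pval q)].

Definition PiHom (x y : V) : Type :=
  {A : set (PathSpace x y) | exists p, A = hclass p}.

Definition pi_class x y (p : PathSpace x y) : PiHom x y :=
  exist _ (hclass p) (ex_intro _ p erefl).

Definition qtop_open x y (U : set (PiHom x y)) : Prop :=
  open (@pi_class x y @^-1` U).

Definition concat (f g : unit_interval -> realization) (t : unit_interval) :=
  if val t <= 2^-1 then f (clampI (2 * val t)) else g (clampI (2 * val t - 1)).

Definition reverse (f : unit_interval -> realization) (t : unit_interval) :=
  f (clampI (1 - val t)).

Definition pi_comp x y z (a : PiHom x y) (b : PiHom y z) (c : PiHom x z) :=
  exists p q r, sval a p /\ sval b q /\ sval c r /\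
    forall t, pval r t = concat (pval p) (pval q) t.

Definition pi_inv x y (a : PiHom x y) (c : PiHom y x) :=
  exists p r, sval a p /\ sval c r /\ forall t, pval r t = reverse (pval p) t.

Definition pi_id x (a : PiHom x x) :=
  exists p, sval a p /\ forall t, pval p t = vtx x.

Definition is_topology (T : Type) (O : set (set T)) :=
  O setT /\ (forall A B, O A -> O B -> O (A `&` B)) /\
  (forall (I : Type) (F : I -> set T), (forall i, O (F i)) -> O (\bigcup_i F i)).

Definition topgroupoid_topology (O : forall x y, set (set (PiHom x y))) :=
  (forall x y, is_topology (O x y)) /\
  (forall x y z (W : set (PiHom x z)) a b c, O x z W -> pi_comp a b c -> W c ->
     exists (U : set (PiHom x y)) (U' : set (PiHom y z)),
       O x y U /\ O y z U' /\ U a /\ U' b /\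
       forall a' b' c', U a' -> U' b' -> pi_comp a' b' c' -> W c') /\
  (forall x y (W : set (PiHom y x)) a c, O y x W -> pi_inv a c -> W c ->
     exists U : set (PiHom x y), O x y U /\ U a /\
       forall a' c', U a' -> pi_inv a' c' -> W c').

(* The reflection tau(pi^qtop) keeps the groupoid and takes on each hom-set
   the supremum of all Top-groupoid topologies coarser than the quotient
   topology; this supremum is again such a topology, hence its open sets are
   exactly the sets open for one of them. *)
Definition tau_open x y (U : set (PiHom x y)) : Prop :=
  exists O : forall x y, set (set (PiHom x y)),
    topgroupoid_topology O /\
    (forall x y (W : set (PiHom x y)), O x y W -> qtop_open W) /\
    O x y U.

Definition jmap x y (c : Pi0 x y) (a : PiHom x y) : Prop :=
  exists (e : Gxy x y) (p : PathSpace x y),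
    pi0_class e = c /\ sval a p /\ forall t, pval p t = alpha (val e) t.

Definition pi_functor (H : TopGroupoid) (f0 : V -> tg_ob H)
    (F : forall x y, PiHom x y -> @tg_hom H (f0 x) (f0 y)) :=
  (forall x y z (a : PiHom x y) (b : PiHom y z) c,
      pi_comp a b c -> F x z c = tg_comp (F x y a) (F y z b)) /\
  (forall x (a : PiHom x x), pi_id a -> F x x a = @tg_id H (f0 x)).

Definition pi_tau_continuous (H : TopGroupoid) (f0 : V -> tg_ob H)
    (F : forall x y, PiHom x y -> @tg_hom H (f0 x) (f0 y)) :=
  forall x y (W : set (@tg_hom H (f0 x) (f0 y))), open W -> tau_open (F x y @^-1` W).

Definition factors_through_j (H : TopGroupoid) (f0 : V -> tg_ob H)
    (f : forall x y, Pi0 x y -> @tg_hom H (f0 x) (f0 y))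
    (F : forall x y, PiHom x y -> @tg_hom H (f0 x) (f0 y)) :=
  forall x y (c : Pi0 x y) (a : PiHom x y), jmap c a -> F x y a = f x y c.

Definition pi_tau_free_on_pi0 : Prop :=
  (forall x y (W : set (PiHom x y)), tau_open W ->
      pi0_open [set c | exists a, jmap c a /\ W a]) /\
  (forall (H : TopGroupoid) (f0 : V -> tg_ob H)
          (f : forall x y, Pi0 x y -> @tg_hom H (f0 x) (f0 y)),
     (forall x y (W : set (@tg_hom H (f0 x) (f0 y))), open W ->
        pi0_open (f x y @^-1` W)) ->
     exists F : forall x y, PiHom x y -> @tg_hom H (f0 x) (f0 y),
       [/\ pi_functor F, pi_tau_continuous F, factors_through_j f F &
        forall G : forall x y, PiHom x y -> @tg_hom H (f0 x) (f0 y),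
          pi_functor G -> pi_tau_continuous G -> factors_through_j f G ->
          forall x y a, G x y a = F x y a]).

End TopGraph.

(* Main.v *)
Require Import Defs.
From HB Require Import structures.
From mathcomp Require Import all_boot all_order all_algebra.
From mathcomp Require Import all_classical reals topology normedtype.
From mathcomp Require Import finmap lra.
Import numFieldNormedType.Exports.
Local Open Scope classical_set_scope.

(** The fundamental groupoid is computed by lifting paths along a cocycle with
    values in the target groupoid [H].  Cover [|Gamma|] by the stars [B(x, 1/2)]
    and by the edge spaces [Gamma(x, y) x (0, 1)].  A Top-graph morphism
    [f : pi_0(Gamma) -> H] defines a cocycle on this cover: the transition from
    [Gamma(x, y) x (0, 1)] to a star is trivial on the first halves of the edges
    and is [f [e]] on the second half of [e].  Along a path the cocycle is
    locally constant, so a lift (one arrow of [H] for each time and chart,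
    compatible with the transitions and locally constant in time) exists and is
    unique given its initial value.  Its final value depends on the path in the
    same way as the transitions do: locally constantly in a homotopy, since
    [f [e]] only depends on path components, and continuously in the
    compact-open topology, since [f] is continuous.  This gives the functor [F]
    extending [f], and the topology induced by [F] witnesses its continuity for
    [tau(pi^qtop)].  For uniqueness, if [G] is any functor extending [f], closing
    up each initial segment of a path by contracting the current chart to its
    base vertex and applying [G] yields a lift of the path with final value
    [G [p]]. *)

Set Implicit Arguments.
Unset Strict Implicit.
Unset Printing Implicit Defensive.

Import Order.TTheory GRing.Theory Num.Theory.
Local Open Scope ring_scope.

(** * The realization and its paths *)

Section Continuity.

Lemma continuous_pair (S T U : topologicalType) (f : S -> T) (g : S -> U) :
  continuous f -> continuous g -> continuous (fun s => (f s, g s)).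
Proof. by move=> cf cg s; apply: cvg_pair; [exact: cf|exact: cg]. Qed.

Lemma continuous_compose (S T U : topologicalType) (f : S -> T) (g : T -> U) :
  continuous f -> continuous g -> continuous (fun s => g (f s)).
Proof. by move=> cf cg s; exact: (continuous_comp (cf s) (cg _)). Qed.

Lemma continuous_addR (R : realType) (S : topologicalType) (f g : S -> R) :
  continuous f -> continuous g -> continuous (fun s => f s + g s).
Proof. by move=> cf cg s; exact: cvgD (cf s) (cg s). Qed.

Lemma continuous_subR (R : realType) (S : topologicalType) (f g : S -> R) :
  continuous f -> continuous g -> continuous (fun s => f s - g s).
Proof. by move=> cf cg s; exact: cvgB (cf s) (cg s). Qed.

Lemma continuous_mulR (R : realType) (S : topologicalType) (f g : S -> R) :
  continuous f -> continuous g -> continuous (fun s => f s * g s).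
Proof. by move=> cf cg s; exact: cvgM (cf s) (cg s). Qed.

Lemma continuous_cst (S T : topologicalType) (c : T) : continuous (fun _ : S => c).
Proof. by move=> s; exact: cvg_cst. Qed.

Lemma continuous_glue (R : realType) (S T : topologicalType) (f g : S -> T)
    (h : S -> R) (c : R) :
  continuous f -> continuous g -> continuous h ->
  (forall s, h s = c -> f s = g s) ->
  continuous (fun s => if h s <= c then f s else g s).
Proof.
move=> cf cg ch fg s W /=; have [hs|hs|hs] := ltgtP (h s) c.
- move=> Wf; have {}Wf : nbhs s (f @^-1` W) := cf s _ Wf.
  have hn : nbhs s (h @^-1` [set z | z < c]) := ch s _ (lt_nbhsl hs).
  apply: filterS2 hn Wf => t /= ht Wt.
  by rewrite ltW.
- move=> Wg; have {}Wg : nbhs s (g @^-1` W) := cg s _ Wg.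
  have hn : nbhs s (h @^-1` [set z | c < z]) := ch s _ (lt_nbhsr hs).
  apply: filterS2 hn Wg => t /= ht Wt.
  by rewrite leNgt ht.
- move=> Wf; have Wg := Wf; rewrite fg // in Wg.
  have {}Wf : nbhs s (f @^-1` W) := cf s _ Wf.
  have {}Wg : nbhs s (g @^-1` W) := cg s _ Wg.
  by apply: filterS2 Wf Wg => t /= Wft Wgt; case: ifP.
Qed.

(** Connectedness of the line, applied to the clopen set of those [r] whose clamp to [[a, b]]
    satisfies [A]. This replaces the subdivision of a path into finitely many pieces lying in
    charts. *)
Lemma segment_ind (R : realType) (A : R -> Prop) (a b : R) :
  a <= b -> A a ->
  (forall s, a <= s <= b -> \forall s' \near s, a <= s' <= b -> (A s <-> A s')) ->
  A b.
Proof.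
move=> ab Aa hA.
pose c (r : R) := Num.max a (Num.min r b).
have cab r : a <= c r <= b by rewrite /c le_max lexx /= ge_max ab ge_min lexx orbT.
have cc : continuous c.
  move=> r; apply: (@continuous_max _ _ (fun=> a) (fun r => Num.min r b)).
    exact: cst_continuous.
  apply: (@continuous_min _ _ id (fun=> b)); [exact: id|exact: cst_continuous].
have cE r : a <= r <= b -> c r = r by case/andP=> ar rb; rewrite /c min_l // max_r.
have near_c r : \forall r' \near r, A (c r) <-> A (c r').
  have hn : nbhs r (c @^-1` [set s' | a <= s' <= b -> (A (c r) <-> A s')]).
    by apply: cc; exact: hA.
  by apply: filterS hn => r' /=; apply.
have ho : open [set r | A (c r)].
  rewrite openE => r /= Ar; rewrite /interior; apply: filterS (near_c r) => r' h.
  exact/h.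
have hc : closed [set r | A (c r)].
  rewrite -openC openE => r /= Ar; rewrite /interior; apply: filterS (near_c r) => r' h.
  by move=> /h.
have conn : connected [set: R].
  by apply/connected_intervalP => x y _ _ z _.
have : [set r | A (c r)] = setT.
  apply: conn; first by exists a; rewrite /= cE ?lexx.
  - by exists [set r | A (c r)] => //; rewrite setTI.
  - by exists [set r | A (c r)] => //; rewrite setTI.
by move=> /seteqP[_ /(_ b Logic.I)] /=; rewrite cE // lexx andbT.
Qed.

End Continuity.

(** * The unit interval as a retract of the line *)

Section UnitInterval.
Variable R : realType.
Local Notation I01 := (unit_interval R).

Lemma projI_subproof (r : R) :
  Num.max 0 (Num.min r 1) \in (`[0, 1]%classic : set R).
Proof.
by apply/mem_set; rewrite /= in_itv /= le_max lexx /= ge_max ler01 ge_min lexx orbT.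
Qed.

(* Unlike [clampI], which sends everything outside [0, 1] to 0, this retraction
   is continuous. *)
Definition projI (r : R) : I01 :=
  exist (fun t : R => t \in (`[0, 1]%classic : set R)) _ (projI_subproof r).

Lemma val_projI (r : R) : val (projI r) = Num.max 0 (Num.min r 1).
Proof. by []. Qed.

Lemma unit_intervalP (t : I01) : 0 <= val t <= 1.
Proof. by case: t => t /= /set_mem; rewrite /= in_itv. Qed.

Lemma projI_val (r : R) : 0 <= r <= 1 -> val (projI r) = r.
Proof. by case/andP=> r0 r1; rewrite /= min_l // max_r. Qed.

Lemma projIK (t : I01) : projI (val t) = t.
Proof. by apply/val_inj; rewrite projI_val ?unit_intervalP. Qed.

Lemma clampIE (r : R) : 0 <= r <= 1 -> clampI r = projI r.
Proof.
move=> r01; apply/val_inj; rewrite projI_val // /clampI.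
case: pselect => //= h; case: h; apply/mem_set.
by rewrite /= in_itv.
Qed.

Lemma projI0 (r : R) : r <= 0 -> projI r = i0 R.
Proof.
move=> r0; apply/val_inj; rewrite val_projI /=.
by rewrite min_l ?max_l //; apply: le_trans r0 ler01.
Qed.

Lemma projI1 (r : R) : 1 <= r -> projI r = i1 R.
Proof. by move=> r1; apply/val_inj; rewrite val_projI /= min_r ?max_r. Qed.

Lemma continuous_to_subtype (T X : topologicalType) (A : set X) (f : T -> set_type A) :
  (forall t, {for t, continuous (fun t => val (f t))}) -> continuous f.
Proof.
move=> cf t W [_ [[B oB <-] Bft sB]].
apply: filterS sB _; exact: (cf t B (open_nbhs_nbhs (conj oB Bft))).
Qed.

Lemma subtype_val_continuous (X : topologicalType) (A : set X) :
  continuous (fun t : set_type A => val t).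
Proof. exact: initial_continuous. Qed.

Lemma projI_continuous : continuous projI.
Proof.
apply: continuous_to_subtype => r.
rewrite /projI /=; apply: continuous_max; first exact: cst_continuous.
by apply: continuous_min; [exact: id|exact: cst_continuous].
Qed.

Lemma unit_interval_val_continuous : continuous (fun t : I01 => val t).
Proof. exact: subtype_val_continuous. Qed.

End UnitInterval.

(** * Topology of the realization: basic neighborhoods, charts and their contractions *)

Section Realization.
Variables (R : realType) (V : Type) (E : topologicalType) (d0 d1 : E -> V).
Hypothesis hd0 : forall v : V, open (d0 @^-1` [set v]).
Hypothesis hd1 : forall v : V, open (d1 @^-1` [set v]).
Local Notation X :=
  (Defs_realization__canonical__topology_structure_Topological R d0 d1).
Local Notation I01 := (unit_interval R).

Lemma realization_basis_open (B : set X) :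
  realization_basis d0 d1 B -> open B.
Proof.
move=> bB; exists [set B]; last by rewrite bigcup_set1.
move=> _ ->; exists [fset B]%fset.
  by move=> A /fset1P ->; apply/mem_set.
by rewrite set_fset1 bigcap_set1.
Qed.

(** The vertex and edge neighborhoods generate the topology as a subbase, and a filter absorbs
    finite intersections. *)
Lemma cvg_realization (T : Type) (F : set_system T) (f : T -> X) (u : X) :
  Filter F ->
  (forall B, realization_basis d0 d1 B -> B u -> F [set t | B (f t)]) ->
  f @ F --> u.
Proof.
move=> FF FB A; rewrite nbhsE => -[_ [[D sD <-] [C DC Cu]] sA].
apply: filterS sA _; apply: (@filterS _ _ _ C); first by move=> v Cv; exists C.
have [D' sD' DC'] := sD _ DC; rewrite -DC'; apply: filter_bigI => B DB.
have /set_mem bB := sD' _ DB; apply: FB => //.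
by move: Cu; rewrite -DC'; apply.
Qed.

(** The edge path extended to all real parameters by its end vertices, so that arithmetic on
    parameters carries no membership proofs. *)
Definition edgept (e : E) (r : R) : X := alpha d0 d1 e (projI r).

Lemma edgept_le0 e r : r <= 0 -> edgept e r = inl (d0 e).
Proof.
move=> r0; rewrite /edgept projI0 // /alpha; case: pselect => /=.
  by move=> /[dup] /set_mem /=; rewrite in_itv /= ltxx.
by rewrite eqxx.
Qed.

Lemma edgept_ge1 e r : 1 <= r -> edgept e r = inl (d1 e).
Proof.
move=> r1; rewrite /edgept projI1 // /alpha; case: pselect => /=.
  by move=> /[dup] /set_mem /=; rewrite in_itv /= ltxx andbF.
by rewrite oner_eq0.
Qed.

Definition oval (t : open01 R) : R := val t.

Lemma open01P (t : open01 R) : 0 < oval t < 1.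
Proof. by rewrite /oval; case: t => t /= /set_mem; rewrite /= in_itv. Qed.

Lemma edgept_inr e (t : open01 R) : edgept e (oval t) = inr (e, t).
Proof.
have /andP[t0 t1] := open01P t.
rewrite /edgept /alpha; have vt : val (projI (oval t)) = oval t.
  by rewrite projI_val // !ltW.
case: pselect => [h|]; last by case; rewrite vt /oval; case: (t).
by congr (inr (_, _)); apply/val_inj.
Qed.

Lemma edgept_mid e (r : R) : 0 < r < 1 ->
  exists2 t : open01 R, oval t = r & edgept e r = inr (e, t).
Proof.
move=> r01; have h : r \in (`]0, 1[%classic : set R).
  by apply/mem_set; rewrite /= in_itv.
by exists (exist _ r h) => //; rewrite -edgept_inr.
Qed.

Lemma alphaE e (t : I01) : alpha d0 d1 e t = edgept e (val t).
Proof. by rewrite /edgept projIK. Qed.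

Variant edgept_spec e r : X -> Type :=
| Edgept0 of r <= 0 : edgept_spec e r (inl (d0 e))
| Edgept1 of 1 <= r : edgept_spec e r (inl (d1 e))
| EdgeptM (t : open01 R) of oval t = r & 0 < r < 1 : edgept_spec e r (inr (e, t)).

Lemma edgeptP e r : edgept_spec e r (edgept e r).
Proof.
have [r0|r0] := leP r 0; first by rewrite edgept_le0 //; constructor.
have [r1|r1] := leP 1 r; first by rewrite edgept_ge1 //; constructor.
have /cid2[t vt ->] : exists2 t : open01 R, oval t = r & edgept e r = inr (e, t).
  by apply: edgept_mid; rewrite r0.
by constructor => //; rewrite r0.
Qed.

Definition star (x : V) (r : R) : set X := 
  [set p | p = inl x \/ exists (e : E) (t : open01 R), p = inr (e, t) /\
             ((d0 e = x /\ oval t < r) \/ (d1 e = x /\ 1 - r < oval t))].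

(** Edge neighborhoods written with a set [O] of the whole edge space, of which only the trace on
    the edges from [x] to [y] counts. *)
Definition edgebox (x y : V) (O : set E) (a b : R) : set X := 
  [set p | exists (e : E) (t : open01 R), p = inr (e, t) /\
             [/\ O e, d0 e = x, d1 e = y & a < oval t < b]].

Lemma star_open x r : 0 < r < 1 -> open (star x r).
Proof. by move=> r01; apply: realization_basis_open; left; exists x, r. Qed.

Lemma edgebox_edge_nbhd x y (U : set (Gxy d0 d1 x y)) a b :
  [set p : X | exists (e : Gxy d0 d1 x y) (t : open01 R),
           p = inr (val e, t) /\ U e /\ a < oval t < b] =
  edgebox x y (val @` U) a b.
Proof.
apply/seteqP; split=> p.
  move=> [e [t [-> [Ue tab]]]]; exists (val e), t; split=> //.
  have [h1 h2] : d0 (val e) = x /\ d1 (val e) = y by case: e {Ue} => e /= /set_mem.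
  by split => //; exists e.
move=> [_ [t [-> [[e Ue <-] ex ey tab]]]]; exists e, t; split=> //.
Qed.

Lemma edgebox_open x y (O : set E) a b : open O -> 0 < a -> a < b -> b < 1 ->
  open (edgebox x y O a b).
Proof.
move=> oO a0 ab b1; apply: realization_basis_open; right.
exists x, y, (val @^-1` O), a, b; do !split => //; first by exists O.
rewrite edgebox_edge_nbhd; apply/seteqP; split=> _ [e [t [-> [Oe ex ey tab]]]];
  exists e, t; split=> //; split=> //.
  have h : e \in [set e : E | d0 e = x /\ d1 e = y] by apply/mem_set.
  by exists (exist _ e h).
by case: Oe => e' ? <-.
Qed.

Lemma realization_basisP (B : set X) : realization_basis d0 d1 B ->
  (exists x r, 0 < r < 1 /\ B = star x r) \/
  (exists x y O a b, [/\ open O, 0 < a, a < b, b < 1 & B = edgebox x y O a b]).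
Proof.
case=> [[x [r [r01 ->]]]|[x [y [U [a [b [oU [a0 [ab [b1 ->]]]]]]]]]].
  by left; exists x, r.
right; case: oU => O oO OU; exists x, y, O, a, b; split => //.
rewrite edgebox_edge_nbhd -OU.
apply/seteqP; split=> _ [e [t [-> [Oe ex ey tab]]]];
  exists e, t; split=> //; split=> //.
  by case: Oe => e' ? <-.
have h : e \in [set e : E | d0 e = x /\ d1 e = y] by apply/mem_set.
by exists (exist _ e h).
Qed.

Lemma star_edgept x r e s : 0 < r < 1 ->
  star x r (edgept e s) <-> (d0 e = x /\ s < r) \/ (d1 e = x /\ 1 - r < s).
Proof.
move=> /andP[r0 r1]; case: edgeptP => [s0|s1|t <- s01].
- split=> [[[->]|[? [? []//]]]|]; first by left; split=> //; lra.
  by case=> [[<- _]|[_ ?]]; [left|lra].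
- split=> [[[->]|[? [? []//]]]|]; first by right; split=> //; lra.
  by case=> [[_ ?]|[<- _]]; [lra|left].
- split=> [[//|[e' [t' [[<- <-] //]]]]|h]; by right; exists e, t.
Qed.

Lemma edgebox_edgept x y O a b e s : 0 < a -> b < 1 ->
  edgebox x y O a b (edgept e s) <-> [/\ O e, d0 e = x, d1 e = y & a < s < b].
Proof.
move=> a0 b1; case: edgeptP => [s0|s1|t <- s01].
- by split=> [[? [? []//]]|[? ? ? ?]]; lra.
- by split=> [[? [? []//]]|[? ? ? ?]]; lra.
- by split=> [[e' [t' [[<- <-] //]]]|h]; exists e, t.
Qed.

(** Openness of the fibres of [d0] and [d1] keeps the end vertices constant for edges close to [e0],
    so membership in a basic neighborhood becomes an open condition on the edge and the
    parameter. *)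
Lemma edgept_cvg (T : Type) (F : set_system T) (e : T -> E) (s : T -> R) e0 s0 :
  Filter F -> e @ F --> e0 -> s @ F --> s0 ->
  (fun t => edgept (e t) (s t)) @ F --> edgept e0 s0.
Proof.
move=> FF ce cs; apply: cvg_realization.
have ed0 x : d0 e0 = x -> F [set t | d0 (e t) = x].
  by move=> ex; apply: (ce (d0 @^-1` [set x])); exact: open_nbhs_nbhs.
have ed1 x : d1 e0 = x -> F [set t | d1 (e t) = x].
  by move=> ex; apply: (ce (d1 @^-1` [set x])); exact: open_nbhs_nbhs.
have elt r : s0 < r -> F [set t | s t < r].
  by move=> sr; apply: (cs [set z | z < r]); exact: lt_nbhsl.
have egt r : r < s0 -> F [set t | r < s t].
  by move=> sr; apply: (cs [set z | r < z]); exact: lt_nbhsr.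
move=> B /realization_basisP[[x [r [r01 ->]]]|].
  move/star_edgept => /(_ r01) h.
  have : F [set t | (d0 (e t) = x /\ s t < r) \/ (d1 (e t) = x /\ 1 - r < s t)].
    case: h => -[h1 h2].
      by apply: filterS2 (ed0 _ h1) (elt _ h2) => t; left.
    by apply: filterS2 (ed1 _ h1) (egt _ h2) => t; right.
  by apply: filterS => t h'; apply/star_edgept.
move=> [x [y [O [a [b [oO a0 ab b1 ->]]]]]] /edgebox_edgept => /(_ a0 b1).
move=> [Oe ex ey /andP[sa sb]].
have hO : F [set t | O (e t)].
  by apply: (ce O); exact: open_nbhs_nbhs.
have h1 := @filterI _ F FF _ _ (ed0 _ ex) (ed1 _ ey).
have h2 := @filterI _ F FF _ _ (egt _ sa) (elt _ sb).
have := @filterI _ F FF _ _ hO (@filterI _ F FF _ _ h1 h2).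
apply: filterS => t [? [[? ?] [? ?]]]; apply/edgebox_edgept => //.
by split=> //; apply/andP.
Qed.

Lemma edgept_continuous (T : topologicalType) (e : T -> E) (s : T -> R) :
  continuous e -> continuous s -> continuous (fun t => edgept (e t) (s t) : X).
Proof. by move=> ce cs t; apply: edgept_cvg; [exact: ce|exact: cs]. Qed.


(* [inl x] is the star of radius 1/2 at [x], [inr (x, y)] the space of open
   edges from [x] to [y], based at [x]. *)
Definition chart_index : Type := (V + V * V)%type.

Definition chart (K : chart_index) : set X := fun u =>
  match K, u with
  | inl x, inl y => y = x
  | inl x, inr (e, t) => (d0 e = x /\ oval t < 2^-1) \/ (d1 e = x /\ 2^-1 < oval t)
  | inr (x, y), inl _ => False
  | inr (x, y), inr (e, t) => d0 e = x /\ d1 e = y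
  end.

Definition chart_base (K : chart_index) : V :=
  match K with inl x => x | inr (x, y) => x end.

Lemma nbhs_inl (x : V) (r : R) : 0 < r < 1 -> nbhs (inl x : X) (star x r).
Proof. by move=> r01; apply: open_nbhs_nbhs; split; [exact: star_open|left]. Qed.

Lemma nbhs_inr (e : E) (t : open01 R) (O : set E) (a b : R) :
  open O -> O e -> a < oval t < b ->
  nbhs (inr (e, t) : X) (edgebox (d0 e) (d1 e) O a b).
Proof.
move=> oO Oe /andP[ta tb]; have /andP[t0 t1] := open01P t.
(* [edgebox_open] asks for an interval strictly inside (0, 1), so the interval is cut at the
   midpoints between the parameter and 0, 1. *)
pose a' := Num.max a (oval t / 2); pose b' := Num.min b ((oval t + 1) / 2).
have a't : a' < oval t by rewrite gt_max ta /=; lra.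
have b't : oval t < b' by rewrite lt_min tb /=; lra.
have a'0 : 0 < a' by rewrite lt_max; apply/orP; right; lra.
have b'1 : b' < 1 by rewrite gt_min; apply/orP; right; lra.
have : nbhs (inr (e, t) : X) (edgebox (d0 e) (d1 e) O a' b').
  apply: open_nbhs_nbhs; split; first by apply: edgebox_open => //; exact: lt_trans a't b't.
  by exists e, t; split=> //; split=> //; rewrite a't.
apply: filterS => _ [e' [t' [-> [Oe' ex ey /andP[h1 h2]]]]].
exists e', t'; split=> //; split=> //; apply/andP; split.
  by apply: le_lt_trans h1; rewrite le_max lexx.
by apply: lt_le_trans h2 _; rewrite ge_min lexx.
Qed.

Lemma chart_open K : open (chart K).
Proof.
rewrite openE => -[z|[e t]]; rewrite /interior.
  case: K => [x /= ->|[x y] //].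
  have h : 0 < (2^-1 : R) < 1 by apply/andP; split; lra.
  apply: filterS (nbhs_inl x h) => _ [-> //|[e [t [-> [[? ?]|[? h2]]]]]] /=.
    by left.
  by right; split=> //; lra.
case: K => [x /=|[x y] /= [ex ey]].
  have /andP[t0 t1] := open01P t.
  case=> -[<- ht].
    have h : 0 < oval t < 2^-1 by rewrite t0.
    apply: filterS (nbhs_inr openT I h) => _ [e' [t' [-> [_ ? ? /andP[? ?]]]]].
    by left.
  have h : 2^-1 < oval t < 1 by rewrite t1 andbT.
  apply: filterS (nbhs_inr openT I h) => _ [e' [t' [-> [_ ? ? /andP[? ?]]]]].
  by right.
apply: filterS (nbhs_inr openT I (open01P t)) => _ [e' [t' [-> [_ e1 e2 _]]]] /=.
by rewrite e1 e2.
Qed.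

Lemma chart_cover (u : X) : exists K, chart K u.
Proof. by case: u => [x|[e t]]; [exists (inl x)|exists (inr (d0 e, d1 e))]. Qed.

Definition ecoord (e0 : E) (u : X) : E := if u is inr (e, _) then e else e0.
Definition tcoord (u : X) : R := if u is inr (_, t) then oval t else 0.

Lemma ecoord_cvg (e0 e : E) (t : open01 R) : ecoord e0 u @[u --> (inr (e, t) : X)] --> e.
Proof.
move=> O; rewrite nbhsE => -[O' [oO' O'e] sO].
apply: filterS (nbhs_inr oO' O'e (open01P t)) => _ [e' [t' [-> [? _ _ _]]]].
exact: sO.
Qed.

Lemma tcoord_cvg (e : E) (t : open01 R) : tcoord u @[u --> (inr (e, t) : X)] --> oval t.
Proof.
move=> W /nbhs_ballP[eps /= eps0 sW].
have h : oval t - eps < oval t < oval t + eps by apply/andP; split; lra.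
apply: filterS (nbhs_inr openT I h) => _ [e' [t' [-> [_ _ _ /andP[? ?]]]]].
by apply: sW; rewrite /ball /= ltr_norml; apply/andP; split; lra.
Qed.

(** In a star each half-edge is drawn linearly to its own end; the jump at 1/2 is harmless because
    the midpoint lies outside every star. In an edge chart everything is drawn to the source. *)
Definition contract_coord (K : chart_index) (t r : R) : R :=
  match K with
  | inl _ => if t < 2^-1 then (1 - r) * t else 1 - (1 - r) * (1 - t)
  | inr _ => (1 - r) * t
  end.

Definition contract (K : chart_index) (u : X) (r : R) : X :=
  match u with
  | inl x => inl x
  | inr (e, t) => edgept e (contract_coord K (oval t) r)
  end.

Lemma contract0 K u : contract K u 0 = u.
Proof.
case: u => [x //|[e t]] /=; rewrite -edgept_inr; congr edgept.
by case: K => [x|[x y]] /=; [case: ifP => _|]; lra.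
Qed.

Lemma contract1 K u : chart K u -> contract K u 1 = inl (chart_base K).
Proof.
case: K u => [x|[x y]] [z|[e t]] //=; first by move=> ->.
  case=> -[<- h].
    by rewrite h edgept_le0 //; lra.
  by rewrite ltNge (ltW h) /= edgept_ge1 //; lra.
by case=> <- _; rewrite edgept_le0 //; lra.
Qed.

(** At a vertex, contraction only moves points nearer to the centre of the star, so small stars are
    mapped into themselves. On an open edge the contraction is a continuous formula in the
    coordinates. *)
Lemma contract_cvg (T : Type) (F : set_system T) K (u : T -> X) (r : T -> R) u0 r0 :
  Filter F -> chart K u0 -> (forall t, 0 <= r t <= 1) ->
  u @ F --> u0 -> r @ F --> r0 ->
  (fun t => contract K (u t) (r t)) @ F --> contract K u0 r0.
Proof.
case: u0 => [x0|[e0 t0]] FF Ku0 r01 cu cr.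
  case: K Ku0 => [x /= ex|[] //]; rewrite {}ex in cu *; apply: cvg_realization => B /realization_basisP[].
    move=> [x' [s [s01 ->]]] [[ex]|[? [? []//]]]; rewrite {}ex in cu *.
    have /andP[s0 s1] := s01.
    (* With radius at most 1/2, the end to which a point of the star is close decides the branch of
       [contract_coord]. *)
    pose s' := Num.min s 2^-1.
    have s's : s' <= s by rewrite ge_min lexx.
    have s'2 : s' <= 2^-1 by rewrite ge_min lexx orbT.
    have s'01 : 0 < s' < 1 by rewrite lt_min s0 /=; apply/andP; split; lra.
    have hs : F [set t | star x' s' (u t)] := cu _ (nbhs_inl x' s'01).
    apply: filterS hs => t /=.
    have /andP[r0' r1'] := r01 t.
    move=> [->|[e [t' [-> h]]]]; first by left.
    have /andP[t'0 t'1] := open01P t'.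
    rewrite /=; apply/star_edgept => //; case: h => -[ex ht].
      left; split=> //; rewrite ifT; last by lra.
      by nra.
    right; split=> //; rewrite ifF; last by apply/negbTE; rewrite -leNgt; lra.
    by nra.
  by move=> [? [? [? [? [? [_ _ _ _ ->]]]]]] [? [? []]].
have hF : F [set t | exists e' t', u t = inr (e', t')].
  have hs : F (u @^-1` edgebox (d0 e0) (d1 e0) setT 0 1).
    exact: cu _ (nbhs_inr openT I (open01P t0)).
  apply: filterS hs => t.
  by move=> [e' [t' [ut _]]]; exists e', t'.
have ce : (fun t => ecoord e0 (u t)) @ F --> e0.
  by move=> A /(@ecoord_cvg e0 e0 t0)/cu.
have ct : (fun t => tcoord (u t)) @ F --> oval t0.
  by move=> A /(@tcoord_cvg e0 t0)/cu.
have cc : (fun t => contract_coord K (tcoord (u t)) (r t)) @ F -->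
    contract_coord K (oval t0) r0.
  have c1 : (fun t => (1 - r t) * tcoord (u t)) @ F --> (1 - r0) * oval t0.
    by apply: cvgM => //; apply: cvgB => //; exact: cvg_cst.
  have c2 : (fun t => 1 - (1 - r t) * (1 - tcoord (u t))) @ F --> 1 - (1 - r0) * (1 - oval t0).
    apply: cvgB; first exact: cvg_cst.
    by apply: cvgM; apply: cvgB => //; exact: cvg_cst.
  case: K Ku0 => [x|[x y]] //= h.
  have [t02|t02] := ltP (oval t0) 2^-1.
    apply: cvg_trans c1; apply: near_eq_cvg.
    have hs : F [set t | tcoord (u t) < 2^-1] := ct _ (lt_nbhsl t02).
    by apply: filterS hs => t /= ->.
  have {t02}h' : 2^-1 < oval t0 by case: h => -[] //; lra.
  apply: cvg_trans c2; apply: near_eq_cvg.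
  have hs : F [set t | 2^-1 < tcoord (u t)] := ct _ (lt_nbhsr h').
  apply: filterS hs => t /= h2.
  by rewrite ltNge (ltW h2).
have := edgept_cvg FF ce cc; apply: cvg_trans; apply: near_eq_cvg.
by apply: filterS hF => t /= [e' [t' ->]].
Qed.

End Realization.

(** * Paths, homotopy classes and concatenation *)

Section Paths.
Variables (R : realType) (V : Type) (E : topologicalType) (d0 d1 : E -> V).
Local Notation X :=
  (Defs_realization__canonical__topology_structure_Topological R d0 d1).
Local Notation I01 := (unit_interval R).
Local Notation path_homotopic := (path_homotopic d0 d1).

Lemma pvalP x y (p : PathSpace R d0 d1 x y) :
  [/\ continuous (pval p : I01 -> X), pval p (i0 R) = inl x & pval p (i1 R) = inl y].
Proof. by case: p => f hf; have [? []] := set_mem hf. Qed.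

Lemma pval_inj x y (p q : PathSpace R d0 d1 x y) : pval p =1 pval q -> p = q.
Proof. by move=> pq; apply/val_inj/funext. Qed.

Lemma path_of x y (g : I01 -> X) : continuous g -> g (i0 R) = inl x ->
  g (i1 R) = inl y -> exists p : PathSpace R d0 d1 x y, pval p = g.
Proof.
move=> cg g0 g1.
have h : (g : @compact_open I01 X) \in @is_path R V E d0 d1 x y by apply/mem_set.
by exists (exist (fun f : @compact_open I01 X => f \in @is_path R V E d0 d1 x y) _ h).
Qed.

Lemma homotopic_refl x y (p : PathSpace R d0 d1 x y) :
  path_homotopic x y (pval p) (pval p).
Proof.
have [cp p0 p1] := pvalP p.
exists (fun z => pval p z.1); split=> //.
by apply: continuous_compose cp => ?; exact: cvg_fst.
Qed.

Lemma homotopic_sym x y (f g : I01 -> X) :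
  path_homotopic x y f g -> path_homotopic x y g f.
Proof.
move=> [H [cH [Hf [Hg [Hx Hy]]]]].
have e0 : projI (1 - val (i0 R)) = i1 R by rewrite projI1 //= subr0.
have e1 : projI (1 - val (i1 R)) = i0 R by rewrite projI0 //= subrr.
exists (fun z => H (z.1, projI (1 - val z.2))); split.
  apply: (continuous_compose (g := H)) => //.
  apply: continuous_pair; first by move=> ?; exact: cvg_fst.
  apply: continuous_compose (@projI_continuous R) => z.
  apply: cvgB; first exact: cvg_cst.
  by apply: continuous_compose (@unit_interval_val_continuous R) z => ?; exact: cvg_snd.
split=> [s|]; first by rewrite e0.
by split=> [s|]; first by rewrite e1.
Qed.

Lemma homotopic_trans x y (f g h : I01 -> X) :
  path_homotopic x y f g -> path_homotopic x y g h -> path_homotopic x y f h.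
Proof.
move=> [H [cH [Hf [Hg [Hx Hy]]]]] [H' [cH' [Hg' [Hh [Hx' Hy']]]]].
have cv : continuous (fun z : I01 * I01 => val z.2).
  by apply: continuous_compose (@unit_interval_val_continuous R) => ?; exact: cvg_snd.
exists (fun z => if val z.2 <= 2^-1 then H (z.1, projI (2 * val z.2))
                 else H' (z.1, projI (2 * val z.2 - 1))); split.
  apply: continuous_glue => //.
  - apply: (continuous_compose (g := H)) => //.
    apply: continuous_pair; first by move=> ?; exact: cvg_fst.
    apply: continuous_compose (@projI_continuous R) => z.
    by apply: cvgM; [exact: cvg_cst|exact: cv].
  - apply: (continuous_compose (g := H')) => //.
    apply: continuous_pair; first by move=> ?; exact: cvg_fst.
    apply: continuous_compose (@projI_continuous R) => z.
    apply: cvgB; last exact: cvg_cst.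
    by apply: cvgM; [exact: cvg_cst|exact: cv].
  - move=> z hz; have e : 2 * 2^-1 = 1 :> R by lra.
    by rewrite hz e subrr projI1 // projI0 // Hg Hg'.
split=> [s|].
  by rewrite /= invr_ge0 ler0n mulr0 projI0.
split=> [s|].
  rewrite /= ifF; last by apply/negbTE; rewrite -ltNge; lra.
  by rewrite projI1 // mulr1; lra.
by split=> t /=; case: ifP.
Qed.

Lemma PiHom_eq x y (a b : PiHom R d0 d1 x y) : sval a = sval b -> a = b.
Proof.
by case: a b => [A hA] [B hB] /= AB; subst B; congr exist; exact: Prop_irrelevance.
Qed.

Lemma pi_class_eq x y (p q : PathSpace R d0 d1 x y) :
  path_homotopic x y (pval p) (pval q) -> pi_class p = pi_class q.
Proof.
move=> pq; apply: PiHom_eq; apply/seteqP; split=> r /=; rewrite /hclass /=.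
  by move=> pr; apply: homotopic_trans (homotopic_sym pq) pr.
exact: homotopic_trans.
Qed.

Lemma pi_class_sval x y (a : PiHom R d0 d1 x y) p : sval a p -> a = pi_class p.
Proof.
case: a => A [q Aq] /=; subst A => qp; rewrite -(pi_class_eq qp).
exact: PiHom_eq.
Qed.

Lemma sval_pi_class x y (p : PathSpace R d0 d1 x y) : sval (pi_class p) p.
Proof. exact: homotopic_refl. Qed.

Lemma pi_class_surj x y (a : PiHom R d0 d1 x y) : exists p, a = pi_class p.
Proof.
by case: a => A [q Aq]; exists q; exact: PiHom_eq.
Qed.

(** A path extended to the line by constants, so that real reparametrizations apply directly. *)
Definition rpath x y (p : PathSpace R d0 d1 x y) (r : R) : X := pval p (projI r).

Lemma rpath_continuous x y (p : PathSpace R d0 d1 x y) : continuous (rpath p).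
Proof.
by have [cp _ _] := pvalP p; apply: continuous_compose cp; exact: projI_continuous.
Qed.

Lemma rpath_le0 x y (p : PathSpace R d0 d1 x y) r : r <= 0 -> rpath p r = inl x.
Proof. by move=> r0; have [_ p0 _] := pvalP p; rewrite /rpath projI0. Qed.

Lemma rpath_ge1 x y (p : PathSpace R d0 d1 x y) r : 1 <= r -> rpath p r = inl y.
Proof. by move=> r0; have [_ _ p1] := pvalP p; rewrite /rpath projI1. Qed.

Lemma rpath_val x y (p : PathSpace R d0 d1 x y) t : rpath p (val t) = pval p t.
Proof. by rewrite /rpath projIK. Qed.

Lemma path_ofR x y (g : R -> X) : continuous g -> g 0 = inl x -> g 1 = inl y ->
  exists p : PathSpace R d0 d1 x y, forall t, pval p t = g (val t).
Proof.
move=> cg g0 g1; have [p pE] := @path_of x y (fun t => g (val t))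
  (continuous_compose (@unit_interval_val_continuous R) cg) g0 g1.
by exists p => t; rewrite pE.
Qed.

(** Lets homotopies be written as formulas in two real variables, with boundary conditions on the
    unit square. *)
Lemma pi_class_eqR x y (p q : PathSpace R d0 d1 x y) (H : R * R -> X) :
  continuous H ->
  (forall s, 0 <= s <= 1 -> H (s, 0) = rpath p s) ->
  (forall s, 0 <= s <= 1 -> H (s, 1) = rpath q s) ->
  (forall t, 0 <= t <= 1 -> H (0, t) = inl x) ->
  (forall t, 0 <= t <= 1 -> H (1, t) = inl y) ->
  pi_class p = pi_class q.
Proof.
move=> cH Hp Hq Hx Hy; apply: pi_class_eq.
exists (fun z => H (val z.1, val z.2)); split.
  apply: (continuous_compose (g := H)) => //; apply: continuous_pair.
    by apply: continuous_compose (@unit_interval_val_continuous R) => ?; exact: cvg_fst.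
  by apply: continuous_compose (@unit_interval_val_continuous R) => ?; exact: cvg_snd.
split=> [s|]; first by rewrite Hp ?unit_intervalP // rpath_val.
split=> [s|]; first by rewrite Hq ?unit_intervalP // rpath_val.
by split=> t; [apply: Hx|apply: Hy]; exact: unit_intervalP.
Qed.

Lemma concatE x y z (p : PathSpace R d0 d1 x y) (q : PathSpace R d0 d1 y z) t :
  concat (pval p) (pval q) t =
    if val t <= 2^-1 then rpath p (2 * val t) else rpath q (2 * val t - 1).
Proof.
have /andP[t0 t1] := unit_intervalP t.
rewrite /concat; case: ifP => ht; rewrite clampIE //; first by apply/andP; split; lra.
have : 2^-1 < val t by rewrite ltNge ht.
by move=> ?; apply/andP; split; lra.
Qed.

Lemma reverseE x y (p : PathSpace R d0 d1 x y) t :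
  reverse (pval p) t = rpath p (1 - val t).
Proof.
have /andP[t0 t1] := unit_intervalP t.
by rewrite /reverse clampIE //; apply/andP; split; lra.
Qed.

Lemma concat_path x y z (p : PathSpace R d0 d1 x y) (q : PathSpace R d0 d1 y z) :
  exists r : PathSpace R d0 d1 x z, forall t, pval r t = concat (pval p) (pval q) t.
Proof.
have [|||r rE] := @path_ofR x z
  (fun s => if s <= 2^-1 then rpath p (2 * s) else rpath q (2 * s - 1)).
- apply: continuous_glue.
  + apply: continuous_compose (@rpath_continuous _ _ p) => s.
    by apply: cvgM; [exact: cvg_cst|exact: cvg_id].
  + apply: continuous_compose (@rpath_continuous _ _ q) => s.
    apply: cvgB; last exact: cvg_cst.
    by apply: cvgM; [exact: cvg_cst|exact: cvg_id].
  + by move=> s; exact: cvg_id.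
  + move=> s ->; have e : 2 * 2^-1 = 1 :> R by lra.
    by rewrite e subrr rpath_ge1 // rpath_le0.
- by rewrite /= invr_ge0 ler0n mulr0 rpath_le0.
- rewrite ifF; last by apply/negbTE; rewrite -ltNge; lra.
  by rewrite mulr1 rpath_ge1 //; lra.
by exists r => t; rewrite rE concatE.
Qed.

Lemma const_path x : exists p : PathSpace R d0 d1 x x, forall t, pval p t = inl x.
Proof.
have cx : continuous (fun _ : R => inl x : X) by move=> s; exact: cvg_cst.
by have [p pE] := path_ofR cx erefl erefl; exists p.
Qed.

End Paths.

(** * Composition of partially defined arrows *)

Section OptionalArrows.
Variable H : TopGroupoid.
Local Notation hom := (@tg_hom H).

(* Hom-sets may be empty, so functions to arrows that are only defined on part
   of the space cannot be extended by a default value; [None] is used instead. *)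
Definition ocomp (x y z : tg_ob H) (a : option (hom x y)) (b : option (hom y z)) :
    option (hom x z) :=
  if a is Some a' then if b is Some b' then Some (tg_comp a' b') else None else None.

Lemma ocompA x y z w (a : option (hom x y)) (b : option (hom y z)) (c : option (hom z w)) :
  ocomp a (ocomp b c) = ocomp (ocomp a b) c.
Proof. by case: a b c => [a|] [b|] [c|] //=; rewrite tg_assoc. Qed.

Lemma ocomp1l x y (b : option (hom x y)) : ocomp (Some (tg_id x)) b = b.
Proof. by case: b => //= b; rewrite tg_id_l. Qed.

Lemma ocomp1r x y (b : option (hom x y)) : ocomp b (Some (tg_id y)) = b.
Proof. by case: b => //= b; rewrite tg_id_r. Qed.

End OptionalArrows.

(** Balls of the line are convex, so they contain the whole segment from the centre to each of their
    points. *)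
Lemma near_between (R : realType) (P : R -> Prop) (r : R) :
  (\forall z \near r, P z) ->
  \forall r' \near r, forall z, Num.min r r' <= z <= Num.max r r' -> P z.
Proof.
move=> /nbhs_ballP[eps /= eps0 hP]; apply/nbhs_ballP; exists eps => //= r'.
rewrite /ball /= ltr_distl => /andP[h1 h2] z /andP[z1 z2]; apply: hP.
rewrite /ball /= ltr_distl.
move: z1 z2; case: (leP r r') => h z1 z2; apply/andP; split; lra.
Qed.

(** * Lifts along a groupoid-valued cocycle *)

Section Lifts.
Variables (R : realType) (X : topologicalType) (H : TopGroupoid).
Local Notation hom := (@tg_hom H).
Variables (C : Type) (o : C -> tg_ob H) (U : C -> set X).
Variable g : forall K M : C, X -> option (hom (o K) (o M)).
Hypothesis U_open : forall K, open (U K).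
Hypothesis U_cover : forall u, exists K, U K u.
Hypothesis g_id : forall K u, U K u -> g K K u = Some (tg_id (o K)).
Hypothesis g_comp : forall K L M u, U K u -> U L u -> U M u ->
  ocomp (g K L u) (g L M u) = g K M u.
Hypothesis g_near : forall (p : R -> X) K M r, continuous p ->
  U K (p r) -> U M (p r) -> \forall r' \near r, g K M (p r') = g K M (p r).

(** The composite of [g K M u] with [g M K u] is an identity, so neither factor is [None]. *)
Lemma g_some K M u : U K u -> U M u -> exists c, g K M u = Some c.
Proof.
move=> Ku Mu; have := g_comp Ku Mu Ku; rewrite g_id //.
by case: (g K M u) => [c|] //; exists c.
Qed.

(** [L r K] is the lifted arrow at time [r] seen in chart [K]; it is constrained only when [K]
    contains [p r]. Local constancy is relative to [[a, b]], so that lifts restrict to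
    subintervals. *)
Definition is_lift (p : R -> X) (x : tg_ob H)
    (L : R -> forall K, option (hom x (o K))) (a b : R) : Prop :=
  forall r, a <= r <= b ->
  [/\ forall K, U K (p r) -> exists c, L r K = Some c,
      forall K M, U K (p r) -> U M (p r) -> L r M = ocomp (L r K) (g K M (p r)) &
      forall K, U K (p r) -> \forall r' \near r, a <= r' <= b -> L r' K = L r K].

Lemma lift_ext p q x (L : R -> forall K, option (hom x (o K))) a b :
  (forall r, a <= r <= b -> p r = q r) -> is_lift p L a b -> is_lift q L a b.
Proof. by move=> pq hL r rab; have := hL r rab; rewrite pq. Qed.

Lemma lift_sub p x (L : R -> forall K, option (hom x (o K))) a b a' b' :
  a <= a' -> b' <= b -> is_lift p L a b -> is_lift p L a' b'.
Proof.
move=> aa bb hL r /andP[ar rb].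
have [h1 h2 h3] : _ := hL r (introT andP (conj (le_trans aa ar) (le_trans rb bb))).
split=> // K /h3; apply: filterS => r' h /andP[ar' rb']; apply: h.
by rewrite (le_trans aa ar') (le_trans rb' bb).
Qed.

(** Transitions act on the right, so composition with [c] on the left preserves lifts. *)
Lemma lift_comp p x y (c : hom y x) (L : R -> forall K, option (hom x (o K)))
    a b a' b' (f : R -> R) :
  continuous f -> (forall r, a' <= r <= b' -> a <= f r <= b) ->
  is_lift p L a b ->
  is_lift (p \o f) (fun r K => ocomp (Some c) (L (f r) K)) a' b'.
Proof.
move=> cf fab hL r rab; have [h1 h2 h3] := hL _ (fab _ rab).
split.
- by move=> K /h1[d ->]; exists (tg_comp c d).
- by move=> K M Ku Mu; rewrite (h2 K M) // ocompA.
- move=> K /h3 hn.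
  have {}hn : nbhs r (f @^-1` [set r' | a <= r' <= b -> L r' K = L (f r) K]) := cf r _ hn.
  by apply: filterS hn => r' /= hr' /fab/hr' ->.
Qed.

Lemma lift_const p x (L : R -> forall K, option (hom x (o K))) a b K :
  a <= b -> is_lift p L a b -> (forall r, a <= r <= b -> U K (p r)) -> L b K = L a K.
Proof.
move=> ab hL hU; apply: (@segment_ind R (fun r => L r K = L a K) a b ab) => // r rab.
have [_ _ /(_ K (hU r rab)) hn] := hL r rab.
by apply: filterS hn => r' h /h ->.
Qed.

(** Agreement in one chart spreads to all charts at the same time through the transitions, and local
    constancy of both lifts makes agreement a locally constant property of time. *)
Lemma lift_unique p x (L L' : R -> forall K, option (hom x (o K))) a b K0 :
  continuous p -> a <= b -> is_lift p L a b -> is_lift p L' a b ->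
  U K0 (p a) -> L a K0 = L' a K0 -> forall K, U K (p b) -> L b K = L' b K.
Proof.
move=> cp ab hL hL' K0a La.
have eqA r K : a <= r <= b -> U K (p r) -> L r K = L' r K ->
    forall M, U M (p r) -> L r M = L' r M.
  move=> rab Kr LL M Mr; have [_ h _] := hL r rab; have [_ h' _] := hL' r rab.
  by rewrite (h K M) // (h' K M) // LL.
apply: (@segment_ind R (fun r => forall K, U K (p r) -> L r K = L' r K) a b ab).
  by apply: (eqA a K0) => //; rewrite lexx.
move=> r rab; have [K Kr] := U_cover (p r).
have [_ _ /(_ K Kr) hn] := hL r rab; have [_ _ /(_ K Kr) hn'] := hL' r rab.
have hU : nbhs r (p @^-1` U K) by apply: cp; exact: open_nbhs_nbhs.
near=> r' => r'ab.
have Kr' : U K (p r') by near: r'.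
have e : L r' K = L r K by apply: (near hn r').
have e' : L' r' K = L' r K by apply: (near hn' r').
split=> h; last first.
  by apply: (eqA r K) => //; rewrite -e // -e' //; exact: h.
by apply: (eqA r' K) => //; rewrite e e'; exact: h.
Unshelve. all: by end_near. Qed.

(** Past time [b] the lift is continued by the transitions out of the single chart [K]; the
    transition rule at [b] makes the two formulas match there. *)
Lemma lift_extend p x (L : R -> forall K, option (hom x (o K))) a b b' K :
  continuous p -> a <= b -> b <= b' -> is_lift p L a b ->
  (forall r, b <= r <= b' -> U K (p r)) ->
  is_lift p
    (fun r M => if r <= b then L r M else ocomp (L b K) (g K M (p r))) a b'.
Proof.
move=> cp ab bb hL hU.
have bb1 : a <= b <= b by rewrite ab lexx.
have [hb1 hb2 hb3] := hL b bb1.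
have Kb : U K (p b) by apply: hU; rewrite lexx.
have [c Lb] := hb1 _ Kb.
move=> r /andP[ar rb']; split.
- move=> M Mr; have [rb|br] := leP r b.
    by have [h _ _] := hL r (introT andP (conj ar rb)); exact: h.
  have Kr : U K (p r) by apply: hU; rewrite rb' ltW.
  by have [d ->] := g_some Kr Mr; rewrite Lb /=; exists (tg_comp c d).
- move=> M N Mr Nr; have [rb|br] := leP r b.
    by have [_ h _] := hL r (introT andP (conj ar rb)); exact: h.
  have Kr : U K (p r) by apply: hU; rewrite rb' ltW.
  by rewrite -ocompA g_comp.
- move=> M Mr; have [rb|br|rb] := ltgtP r b.
  + have [_ _ /(_ M Mr) hn] := hL r (introT andP (conj ar (ltW rb))).
    apply: filterS2 (lt_nbhsl rb) hn => r' /= r'b h /andP[ar' _].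
    by rewrite (ltW r'b) h // ar' ltW.
  + have Kr : U K (p r) by apply: hU; rewrite rb' ltW.
    apply: filterS2 (lt_nbhsr br) (g_near cp Kr Mr) => r' /= br' e _.
    by rewrite leNgt br' /= e.
  + rewrite rb in Mr *.
    apply: filterS2 (hb3 _ Mr) (g_near cp Kb Mr) => r' h e /andP[ar' _].
    have [r'b|br'] := leP r' b; first by rewrite h // ar'.
    by rewrite e -hb2.
Qed.

(** Existence of a lift on [[a, r]] is a locally constant property of [r]: inside one chart, lifts
    extend forward by [lift_extend] and restrict backward. *)
Lemma lift_exists p x a b K0 (c : hom x (o K0)) :
  continuous p -> a <= b -> U K0 (p a) ->
  exists2 L : R -> forall K, option (hom x (o K)), is_lift p L a b & L a K0 = Some c.
Proof.
move=> cp ab K0a.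
pose A r := a <= r -> exists2 L : R -> forall K, option (hom x (o K)),
  is_lift p L a r & L a K0 = Some c.
suff : A b by apply.
apply: (@segment_ind R A a b ab) => [_|r /andP[ar rb]].
  exists (fun r M => ocomp (Some c) (g K0 M (p r))); last by rewrite g_id // ocomp1r.
  move=> r ra; have {ra}-> : r = a by apply/eqP; rewrite eq_le andbC.
  split.
  - by move=> K Ka; have [d ->] := g_some K0a Ka; exists (tg_comp c d).
  - by move=> K M Ka Ma; rewrite -ocompA g_comp.
  - move=> K Ka; near=> r' => ra.
    by have -> : r' = a by apply/eqP; rewrite eq_le andbC.
have ext s s' K : a <= s -> s <= s' -> (forall z, s <= z <= s' -> U K (p z)) -> A s -> A s'.
  move=> as_ ss' hU As _; have [L hL L0] := As as_.
  exists (fun r M => if r <= s then L r M else ocomp (L s K) (g K M (p r))).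
    exact: lift_extend.
  by rewrite as_.
have res s s' : a <= s -> s <= s' -> A s' -> A s.
  move=> as_ ss' As' _; have [L hL L0] := As' (le_trans as_ ss').
  by exists L => //; apply: lift_sub hL.
have [K Kr] := U_cover (p r).
have hU : nbhs r (p @^-1` U K) by apply: cp; exact: open_nbhs_nbhs.
apply: filterS (near_between hU) => r' hz /andP[ar' _].
move: hz; case: (leP r r') => rr' hz; split.
- exact: (ext _ _ K).
- exact: res.
- by apply: res => //; exact: ltW.
- by apply: (ext _ _ K) => //; exact: ltW.
Unshelve. all: by end_near. Qed.

(** [P] abstracts how arrows depend on a parameter; being stable under eventual equality and
    composition, it passes from the initial to the final value. It is used with local constancy (for
    homotopies) and with continuity (for the compact-open topology). The tube hypothesis keeps all
    nearby [Q t] in one chart over a short time, where lifts are constant. *)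
Lemma lift_parameter (T : Type) (F : set_system T) (t0 : T) (Q : T -> R -> X)
    (x : tg_ob H) (L : T -> R -> forall K, option (hom x (o K))) (a b : R) (K0 : C)
    (P : forall y z, (T -> option (hom y z)) -> Prop) :
  Filter F ->
  (forall y z (f f' : T -> option (hom y z)), F [set t | f t = f' t] -> P _ _ f -> P _ _ f') ->
  (forall y z w (f : T -> option (hom y z)) (f' : T -> option (hom z w)),
     P _ _ f -> P _ _ f' -> P _ _ (fun t => ocomp (f t) (f' t))) ->
  continuous (Q t0) -> a <= b ->
  (forall r K, a <= r <= b -> U K (Q t0 r) -> \forall r' \near r,
     a <= r' <= b ->
     F [set t | forall z, Num.min r r' <= z <= Num.max r r' -> U K (Q t z)]) ->
  (forall t, is_lift (Q t) (L t) a b) ->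
  (forall r K M, a <= r <= b -> U K (Q t0 r) -> U M (Q t0 r) ->
     P _ _ (fun t => g K M (Q t r))) ->
  U K0 (Q t0 a) -> P _ _ (fun t => L t a K0) ->
  forall K, U K (Q t0 b) -> P _ _ (fun t => L t b K).
Proof.
move=> FF Pnear Pcomp cQ ab tube hL Pg K0a PL.
have UQ r K : a <= r <= b -> U K (Q t0 r) -> F [set t | U K (Q t r)].
  move=> rab Kr; have := nbhs_singleton (tube r K rab Kr) rab.
  by apply: filterS => t /(_ r); apply; rewrite minxx maxxx lexx.
have PA r K : a <= r <= b -> U K (Q t0 r) -> P _ _ (fun t => L t r K) ->
    forall M, U M (Q t0 r) -> P _ _ (fun t => L t r M).
  move=> rab Kr PLr M Mr; apply: (Pnear _ _ (fun t => ocomp (L t r K) (g K M (Q t r)))).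
    apply: filterS2 (UQ _ _ rab Kr) (UQ _ _ rab Mr) => t /= Kt Mt.
    by have [_ h _] := hL t r rab; rewrite (h K M).
  by apply: Pcomp => //; exact: Pg.
apply: (@segment_ind R (fun r => forall K, U K (Q t0 r) -> P _ _ (fun t => L t r K)) a b ab).
  by apply: (PA a K0) => //; rewrite lexx.
move=> r rab; have [K Kr] := U_cover (Q t0 r).
have hU : nbhs r (Q t0 @^-1` U K) by apply: cQ; exact: open_nbhs_nbhs.
apply: filterS2 hU (tube r K rab Kr) => r' /= Kr' /[swap] r'ab /(_ r'ab) hF.
have eF : F [set t | L t r K = L t r' K].
  have /andP[ar rb] := rab; have /andP[ar' rb'] := r'ab.
  apply: filterS hF => t /=; case: (leP r r') => rr' hz.
    by rewrite (lift_const rr' (lift_sub ar rb' (hL t)) hz).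
  by rewrite (lift_const (ltW rr') (lift_sub ar' rb (hL t)) hz).
split=> h.
  by apply: (PA r' K) => //; apply: Pnear eF _; exact: h.
apply: (PA r K) => //; apply: Pnear (h _ Kr').
by apply: filterS eF => t /= ->.
Qed.

End Lifts.

(** * The cocycle of a morphism on the path-component graph *)

Section Cocycle.
Variables (R : realType) (V : Type) (E : topologicalType) (d0 d1 : E -> V).
Hypothesis hd0 : forall v : V, open (d0 @^-1` [set v]).
Hypothesis hd1 : forall v : V, open (d1 @^-1` [set v]).
Local Notation X :=
  (Defs_realization__canonical__topology_structure_Topological R d0 d1).
Local Notation I01 := (unit_interval R).
Local Notation chart := (@chart R V E d0 d1).

Lemma GxyP x y (e : Gxy d0 d1 x y) : d0 (val e) = x /\ d1 (val e) = y.
Proof. by case: e => e /= /set_mem. Qed.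

Lemma Gxy_of x y (e : E) : d0 e = x -> d1 e = y ->
  exists e' : Gxy d0 d1 x y, val e' = e.
Proof.
move=> ex ey; have h : e \in [set e : E | d0 e = x /\ d1 e = y] by apply/mem_set.
by exists (exist (fun e : E => e \in [set e : E | d0 e = x /\ d1 e = y]) _ h).
Qed.

Lemma path_comp_sym x y (e e' : Gxy d0 d1 x y) :
  path_comp R e e' -> path_comp R e' e.
Proof.
move=> [p [cp [p0 p1]]]; exists (fun t => p (projI (1 - val t))); split.
  apply: continuous_compose cp; apply: continuous_compose (@projI_continuous R).
  by apply: continuous_subR; [exact: continuous_cst|exact: unit_interval_val_continuous].
by split; [rewrite projI1 //= subr0|rewrite projI0 //= subrr].
Qed.

Lemma path_comp_trans x y (e e' e'' : Gxy d0 d1 x y) :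
  path_comp R e e' -> path_comp R e' e'' -> path_comp R e e''.
Proof.
move=> [p [cp [p0 p1]]] [q [cq [q0 q1]]].
have cv := @unit_interval_val_continuous R.
exists (fun t => if val t <= 2^-1 then p (projI (2 * val t))
                 else q (projI (2 * val t - 1))); split.
  apply: continuous_glue => //.
  - apply: continuous_compose cp; apply: continuous_compose (@projI_continuous R).
    by apply: continuous_mulR => //; exact: continuous_cst.
  - apply: continuous_compose cq; apply: continuous_compose (@projI_continuous R).
    apply: continuous_subR; last exact: continuous_cst.
    by apply: continuous_mulR => //; exact: continuous_cst.
  - move=> t ->; have e2 : 2 * 2^-1 = 1 :> R by lra.
    by rewrite e2 subrr projI1 // projI0 // p1 q0.
split; first by rewrite /= invr_ge0 ler0n mulr0 projI0.
rewrite /= ifF; last by apply/negbTE; rewrite -ltNge; lra.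
by rewrite projI1 // mulr1; lra.
Qed.

Lemma path_comp_refl x y (e : Gxy d0 d1 x y) : path_comp R e e.
Proof. by exists (fun=> e); split=> //; exact: continuous_cst. Qed.

Lemma pi0_class_eq x y (e e' : Gxy d0 d1 x y) :
  path_comp R e e' -> pi0_class R e = pi0_class R e'.
Proof.
move=> ee'; have h : path_comp R e = path_comp R e'.
  apply/seteqP; split=> e'' h; last exact: path_comp_trans ee' h.
  exact: path_comp_trans (path_comp_sym ee') h.
rewrite /pi0_class; set h1 := ex_intro _ _ _; set h2 := ex_intro _ _ _.
by move: h1 h2; rewrite h => h1 h2; congr exist; exact: Prop_irrelevance.
Qed.

Lemma pi0_class_path x y (e e' : Gxy d0 d1 x y) :
  pi0_class R e = pi0_class R e' -> path_comp R e e'.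
Proof.
move=> /(congr1 (fun c => sval c)) /= ->; exact: path_comp_refl.
Qed.

(** The edge coordinate is continuous on an edge chart, so it turns a path of the realization into a
    path of edges. *)
Lemma pi0_class_of_chart x y (p : I01 -> X) (e e' : Gxy d0 d1 x y) :
  continuous p -> (forall t, chart (inr (x, y)) (p t)) ->
  ecoord (val e) (p (i0 R)) = val e -> ecoord (val e) (p (i1 R)) = val e' ->
  pi0_class R e = pi0_class R e'.
Proof.
move=> cp hp p0 p1; apply: pi0_class_eq.
have ex t : exists e1 : Gxy d0 d1 x y, val e1 = ecoord (val e) (p t).
  by have := hp t; case: (p t) => // -[e1 t1] [? ?]; exact: Gxy_of.
exists (fun t => projT1 (cid (ex t))); split; last first.
  by split; apply/val_inj; case: cid => /= ? ->.
apply: continuous_to_subtype => t.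
have -> : (fun t => val (projT1 (cid (ex t)))) = (fun t => ecoord (val e) (p t)).
  by apply/funext => s; case: cid.
have := hp t; case E1 : (p t) => [//|[e1 t1]] _.
have ce : ecoord (val e) u @[u --> p t] --> ecoord (val e) (p t).
  by rewrite E1; exact: ecoord_cvg.
by move=> W /ce; exact: cp.
Qed.

(** Stars of radius 1/2 take disjoint halves of the edges. As distinct edge charts are disjoint too,
    only transitions between a star and an edge chart can be nontrivial. *)
Lemma star_unique x y (u : X) : chart (inl x) u -> chart (inl y) u -> x = y.
Proof.
case: u => [z /= -> //|[e t]] /=.
by case=> -[<- tx]; case=> -[ey ty] //; move: (lt_trans tx ty); rewrite ltxx.
Qed.

Lemma edge_unique p q (u : X) : chart (inr p) u -> chart (inr q) u -> p = q.
Proof. by case: p q u => [x y] [x' y'] [//|[e t]] /= [<- <-] [<- <-]. Qed.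

Variables (H : TopGroupoid) (f0 : V -> tg_ob H).
Local Notation hom := (@tg_hom H).
Variable f : forall x y, Pi0 R d0 d1 x y -> hom (f0 x) (f0 y).
Hypothesis f_cont : forall x y (W : set (hom (f0 x) (f0 y))),
  open W -> pi0_open (f (x:=x) (y:=y) @^-1` W).

(** The identity transported along an equality of vertices, needed because the two charts of a
    transition are independent indices. *)
Definition oid (x y : V) : option (hom (f0 x) (f0 y)) :=
  if pselect (x = y) is left e then
    Some (match e in _ = z return hom (f0 x) (f0 z) with erefl => tg_id (f0 x) end)
  else None.

Lemma oidE x : oid x x = Some (tg_id (f0 x)).
Proof.
by rewrite /oid; case: pselect => // e; rewrite (Prop_irrelevance e erefl).
Qed.

Definition oedge (x y : V) (e : E) : option (hom (f0 x) (f0 y)) :=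
  if pselect (exists e' : Gxy d0 d1 x y, val e' = e) is left h
  then Some (f (pi0_class R (projT1 (cid h)))) else None.

Lemma oedgeE x y (e : Gxy d0 d1 x y) : oedge x y (val e) = Some (f (pi0_class R e)).
Proof.
rewrite /oedge; case: pselect => [h|]; last by case; exists e.
by case: cid => /= e' /val_inj ->.
Qed.

Definition oinv x y (a : option (hom x y)) : option (hom y x) :=
  if a is Some a' then Some (tg_inv a') else None.

(** The half of the edge decides the value, not the vertex [z]: for a loop both halves lie in the
    same star. The midpoint, where the formula jumps, lies in no star. *)
Definition leave_edge (x y z : V) (u : X) : option (hom (f0 x) (f0 z)) :=
  match u with
  | inl _ => None
  | inr (e, t) => if oval t < 2^-1 then oid x z else ocomp (oedge x y e) (oid y z)
  end.

Definition transition (K M : chart_index V) (u : X) :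
    option (hom (f0 (chart_base K)) (f0 (chart_base M))) :=
  match K, M return option (hom (f0 (chart_base K)) (f0 (chart_base M))) with
  | inl x, inl y => oid x y
  | inr (x, y), inr (x', y') => oid x x'
  | inr (x, y), inl z => leave_edge x y z u
  | inl z, inr (x, y) => oinv (leave_edge x y z u)
  end.

Lemma leave_edge_lt x y z e (t : open01 R) : oval t < 2^-1 ->
  leave_edge x y z (inr (e, t)) = oid x z.
Proof. by rewrite /leave_edge => ->. Qed.

Lemma leave_edge_gt x y z (e : Gxy d0 d1 x y) (t : open01 R) : 2^-1 < oval t ->
  leave_edge x y z (inr (val e, t)) = ocomp (Some (f (pi0_class R e))) (oid y z).
Proof. by move=> ht; rewrite /leave_edge ltNge (ltW ht) /= oedgeE. Qed.

Lemma edge_star_cases x y z (u : X) : chart (inr (x, y)) u -> chart (inl z) u ->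
  (exists e t, [/\ u = inr (e, t), oval t < 2^-1 & x = z]) \/
  (exists (e : Gxy d0 d1 x y) t, [/\ u = inr (val e, t), 2^-1 < oval t & y = z]).
Proof.
case: u => [//|[e t]] /= [ex ey] [[ez ht]|[ez ht]].
  by left; exists e, t; split=> //; rewrite -ex.
right; have [e' e'E] := Gxy_of ex ey; exists e', t; rewrite e'E; split=> //.
by rewrite -ey.
Qed.

Lemma leave_edge_some x y z (u : X) : chart (inr (x, y)) u -> chart (inl z) u ->
  exists c, leave_edge x y z u = Some c.
Proof.
move=> hu hz; case: (edge_star_cases hu hz) => -[e [t [-> ht ez]]]; subst z.
  by rewrite leave_edge_lt // oidE; eexists.
by rewrite leave_edge_gt // oidE /=; eexists.
Qed.

Lemma transition_id K u : chart K u -> transition K K u = Some (tg_id (f0 (chart_base K))).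
Proof. by case: K => [x|[x y]] _; exact: oidE. Qed.

(** Two of the three charts are of the same kind, hence equal by disjointness; what remains is
    cancellation of units and inverses. *)
Lemma transition_comp K L M u : chart K u -> chart L u -> chart M u ->
  ocomp (transition K L u) (transition L M u) = transition K M u.
Proof.
case: K L M => [x|[x y]] [x'|[x' y']] [x''|[x'' y'']] hK hL hM.
- by move: (star_unique hK hL) (star_unique hL hM) => ? ?; subst; rewrite /= oidE ocomp1l.
- by move: (star_unique hK hL) => ?; subst; rewrite /= oidE ocomp1l.
- move: (star_unique hK hM) => ?; subst; have [c lc] := leave_edge_some hL hM.
  by rewrite /= lc /= tg_inv_l oidE.
- by move: (edge_unique hL hM) => -[? ?]; subst; rewrite /= oidE ocomp1r.
- by move: (star_unique hL hM) => ?; subst; rewrite /= oidE ocomp1r.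
- move: (edge_unique hK hM) => -[? ?]; subst; have [c lc] := leave_edge_some hM hL.
  by rewrite /= lc /= tg_inv_r oidE.
- by move: (edge_unique hK hL) => -[? ?]; subst; rewrite /= oidE ocomp1l.
- by move: (edge_unique hK hL) (edge_unique hL hM) => -[? ?] [? ?]; subst;
    rewrite /= oidE ocomp1l.
Qed.

(** On a second half, the edge coordinate of [p] between the two times is a path of edges, so its
    class does not change. Constancy holds along paths only: nearby points of the realization may
    lie on edges of other path components. *)
Lemma leave_edge_near (p : R -> X) x y z r : continuous p ->
  chart (inr (x, y)) (p r) -> chart (inl z) (p r) ->
  \forall r' \near r, leave_edge x y z (p r') = leave_edge x y z (p r).
Proof.
move=> cp hu hz; have half0 : (0 : R) < 2^-1 by lra.
case: (edge_star_cases hu hz) => -[e [t [pr ht ez]]]; subst z.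
  have h : 0 < oval t < 2^-1 by have /andP[-> _] := open01P t.
  have hn : nbhs r (p @^-1` @edgebox R V E d0 d1 (d0 e) (d1 e) setT 0 2^-1).
    by apply: cp; rewrite pr; exact: nbhs_inr (@openT E) Logic.I h.
  apply: filterS hn => r' /= [e' [t' [-> [_ _ _ /andP[_ ht']]]]].
  by rewrite pr !leave_edge_lt.
have h : 2^-1 < oval t < 1 by have /andP[_ ->] := open01P t; rewrite ht.
have [e0 e1] := GxyP e.
have hn : nbhs r (p @^-1` @edgebox R V E d0 d1 x y setT 2^-1 1).
  have := nbhs_inr d0 d1 (@openT E) (I : setT (val e)) h.
  by rewrite -pr e0 e1; exact: cp.
apply: filterS (near_between hn) => r' hb.
have [|e' [t' [pr' [_ ex' ey' /andP[ht' _]]]]] := hb r'.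
  by rewrite ge_min le_max lexx !orbT.
have [e'' e''E] := Gxy_of ex' ey'; rewrite pr' -e''E pr !leave_edge_gt //.
congr (ocomp (Some (f _)) _); apply/esym.
(* The segment of [p] from [r] to [r'], in either time direction, parametrized by the unit
   interval. *)
pose q (s : I01) := p (r + val s * (r' - r)).
apply: (@pi0_class_of_chart x y q).
- apply: continuous_compose cp; apply: continuous_addR; first exact: continuous_cst.
  by apply: continuous_mulR; [exact: unit_interval_val_continuous|exact: continuous_cst].
- move=> s; rewrite /q; have /andP[s0 s1] := unit_intervalP s.
  have [|e3 [t3 [-> [_ <- <- _]]]] := hb (r + val s * (r' - r)); last by [].
  by case: (leP r r') => rr'; apply/andP; split; nra.
- by rewrite /q /= mul0r addr0 pr.
- by rewrite /q /= mul1r addrC subrK pr' e''E.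
Qed.

Lemma transition_near (p : R -> X) K M r : continuous p ->
  chart K (p r) -> chart M (p r) ->
  \forall r' \near r, transition K M (p r') = transition K M (p r).
Proof.
move=> cp; case: K M => [x|[x y]] [x'|[x' y']] hK hM; rewrite /transition.
- by apply: (@filterS _ (nbhs r) _ setT) => //; exact: filterT.
- by apply: filterS (leave_edge_near cp hM hK) => r' ->.
- exact: leave_edge_near.
- by apply: (@filterS _ (nbhs r) _ setT) => //; exact: filterT.
Qed.

(** Continuity at [t0] along [F] for partially defined arrows, including definedness at [t0] and
    eventually along [F]. *)
Definition ocont (T : Type) (F : set_system T) (t0 : T) y z (a : T -> option (hom y z)) :=
  exists2 c, a t0 = Some c &
    forall W, nbhs c W -> F [set t | exists2 c', a t = Some c' & W c'].

Lemma ocont_cst T (F : set_system T) t0 y z (c : hom y z) : Filter F ->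
  ocont F t0 (fun=> Some c).
Proof.
move=> FF; exists c => // W Wc; apply: filterS filterT => t _; exists c => //.
exact: nbhs_singleton.
Qed.

Lemma ocont_near T (F : set_system T) t0 y z (a b : T -> option (hom y z)) : Filter F ->
  a t0 = b t0 -> F [set t | a t = b t] -> ocont F t0 a -> ocont F t0 b.
Proof.
move=> FF ab0 ab [c ac ha]; exists c; first by rewrite -ab0.
by move=> W /ha; apply: filterS2 ab => t /= ->.
Qed.

Lemma ocont_comp T (F : set_system T) t0 x y z (a : T -> option (hom x y))
  (b : T -> option (hom y z)) : Filter F ->
  ocont F t0 a -> ocont F t0 b -> ocont F t0 (fun t => ocomp (a t) (b t)).
Proof.
move=> FF [c ac ha] [c' bc' hb]; exists (tg_comp c c'); first by rewrite ac bc'.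
move=> W Wc; have := @tg_comp_cont H x y z (c, c') W Wc.
move=> [[A B] /= [/ha hA /hb hB] AB].
apply: filterS2 hA hB => t /= [u -> Au] [v -> Bv] /=.
by exists (tg_comp u v) => //; exact: (AB (u, v)).
Qed.

Lemma ocont_inv T (F : set_system T) t0 x y (a : T -> option (hom x y)) : Filter F ->
  ocont F t0 a -> ocont F t0 (fun t => oinv (a t)).
Proof.
move=> FF [c ac ha]; exists (tg_inv c); first by rewrite ac.
move=> W Wc; have /ha : nbhs c (@tg_inv H x y @^-1` W) by exact: tg_inv_cont.
by apply: filterS => t /= [u -> Wu] /=; exists (tg_inv u).
Qed.

Lemma ocont_compose T (F : set_system T) t0 (u : T -> X) y z (a : X -> option (hom y z)) :
  u @ F --> u t0 -> ocont (nbhs (u t0)) (u t0) a -> ocont F t0 (fun t => a (u t)).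
Proof. by move=> cu [c ac ha]; exists c => // W /ha/cu. Qed.

Lemma leave_edge_cont x y z (u : X) : chart (inr (x, y)) u -> chart (inl z) u ->
  ocont (nbhs u) u (leave_edge x y z).
Proof.
move=> hu hz; have half0 : (0 : R) < 2^-1 by lra.
case: (edge_star_cases hu hz) => -[e [t [pr ht ez]]]; subst z u.
  have h : 0 < oval t < 2^-1 by have /andP[-> _] := open01P t.
  apply: (@ocont_near _ _ _ _ _ (fun=> Some (tg_id (f0 x)))); last exact: ocont_cst.
    by rewrite leave_edge_lt // oidE.
  apply: filterS (nbhs_inr d0 d1 openT Logic.I h) => _ [e' [t' [-> [_ _ _ /andP[_ ht']]]]] /=.
  by rewrite ht' oidE.
have h : 2^-1 < oval t < 1 by have /andP[_ ->] := open01P t; rewrite ht.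
have [e0 e1] := GxyP e.
exists (f (pi0_class R e)); first by rewrite leave_edge_gt // oidE ocomp1r.
move=> W; rewrite nbhsE => -[W' [oW' W'e] sW].
(* Continuity of [f] for the quotient topology: the preimage of [W'] among the edges from [x] to [y]
   is the trace of an open set [O] of [E]. *)
have [O oO OE] := f_cont oW'.
have Oe : O (val e).
  have : (@pi0_class R _ _ d0 d1 x y @^-1` (f (x:=x) (y:=y) @^-1` W')) e by [].
  by rewrite -OE.
apply: filterS (nbhs_inr d0 d1 oO Oe h) => _ [e' [t' [-> [Oe' ex ey /andP[ht' _]]]]].
rewrite e0 in ex; rewrite e1 in ey.
have [e'' e''E] := Gxy_of ex ey; rewrite -e''E in Oe' *.
exists (f (pi0_class R e'')); first by rewrite leave_edge_gt // oidE ocomp1r.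
apply: sW; have : (set_val @^-1` O) e'' by [].
by rewrite OE.
Qed.

Lemma transition_cont K M (u : X) : chart K u -> chart M u ->
  ocont (nbhs u) u (transition K M).
Proof.
case: K M => [x|[x y]] [x'|[x' y']] hK hM; rewrite /transition.
- by have <- := star_unique hK hM; rewrite oidE; exact: ocont_cst.
- by apply: ocont_inv; exact: leave_edge_cont.
- exact: leave_edge_cont.
- by have [<- _] := edge_unique hK hM; rewrite oidE; exact: ocont_cst.
Qed.

End Cocycle.

(** * The value of a path *)

Section PathValue.
Variables (R : realType) (V : Type) (E : topologicalType) (d0 d1 : E -> V).
Hypothesis hd0 : forall v : V, open (d0 @^-1` [set v]).
Hypothesis hd1 : forall v : V, open (d1 @^-1` [set v]).
Local Notation X :=
  (Defs_realization__canonical__topology_structure_Topological R d0 d1).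
Local Notation I01 := (unit_interval R).
Local Notation chart := (@chart R V E d0 d1).
Local Notation PathSpace := (PathSpace R d0 d1).
Variables (H : TopGroupoid) (f0 : V -> tg_ob H).
Local Notation hom := (@tg_hom H).
Variable f : forall x y, Pi0 R d0 d1 x y -> hom (f0 x) (f0 y).

Local Notation lift := (@is_lift R X H (chart_index V) (fun K => f0 (chart_base K))
  chart (transition f)).

(** The holonomy of the cocycle along [p]: the final arrow, in the star of [y], of the lift that
    starts at the identity in the star of [x]. *)
Definition path_value x y (p : PathSpace x y) (c : hom (f0 x) (f0 y)) : Prop :=
  exists L : R -> forall K : chart_index V, option (hom (f0 x) (f0 (chart_base K))),
  [/\ lift (rpath p) L 0 1, L 0 (inl x) = Some (tg_id (f0 x)) & L 1 (inl y) = Some c].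

Let lift_ex (p : R -> X) a b x (K0 : chart_index V) (c : hom x (f0 (chart_base K0))) :
  continuous p -> a <= b -> chart K0 (p a) ->
  exists2 L : R -> forall K, option (hom x (f0 (chart_base K))),
    lift p L a b & L a K0 = Some c.
Proof.
apply: lift_exists.
- exact: chart_open.
- exact: chart_cover.
- exact: transition_id.
- exact: transition_comp.
- by move=> ? ? ? ?; exact: transition_near.
Qed.

Let lift_uniq (p : R -> X) x (L L' : R -> forall K, option (hom x (f0 (chart_base K)))) a b K0 :
  continuous p -> a <= b -> lift p L a b -> lift p L' a b ->
  chart K0 (p a) -> L a K0 = L' a K0 -> forall K, chart K (p b) -> L b K = L' b K.
Proof.
move=> cp ab hL hL' K0a e K.
by apply: lift_unique hL hL' K0a e K => //; [exact: chart_open|exact: chart_cover].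
Qed.

Let chart_rpath0 x y (p : PathSpace x y) : chart (inl x) (rpath p 0).
Proof. by rewrite rpath_le0. Qed.

Let chart_rpath1 x y (p : PathSpace x y) : chart (inl y) (rpath p 1).
Proof. by rewrite rpath_ge1. Qed.

Lemma path_value_lift x y (p : PathSpace x y) :
  exists2 L : R -> forall K : chart_index V, option (hom (f0 x) (f0 (chart_base K))),
    lift (rpath p) L 0 1 & L 0 (inl x) = Some (tg_id (f0 x)).
Proof.
have [L hL L0] := @lift_ex (rpath p) 0 1 (f0 x) (inl x) (tg_id (f0 x))
  (@rpath_continuous _ _ _ _ _ _ _ p) ler01 (chart_rpath0 p).
by exists L.
Qed.

Lemma path_value_of x y (p : PathSpace x y) L :
  lift (rpath p) L 0 1 -> L 0 (inl x) = Some (tg_id (f0 x)) ->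
  exists2 c, path_value p c & L 1 (inl y) = Some c.
Proof.
move=> hL L0; have [|/(_ _ (chart_rpath1 p))[c Lc] _ _] := hL 1.
  by rewrite ler01 lexx.
by exists c => //; exists L.
Qed.

Lemma path_value_exists x y (p : PathSpace x y) : exists c, path_value p c.
Proof.
have [L hL L0] := path_value_lift p.
by have [c pc _] := path_value_of hL L0; exists c.
Qed.

Lemma path_value_lift_eq x y (p : PathSpace x y) c L : path_value p c ->
  lift (rpath p) L 0 1 -> L 0 (inl x) = Some (tg_id (f0 x)) -> L 1 (inl y) = Some c.
Proof.
move=> [L' [hL' L'0 <-]] hL L0.
apply: lift_uniq hL hL' (chart_rpath0 p) _ _ (chart_rpath1 p) => //.
- exact: rpath_continuous.
- by rewrite L0.
Qed.

Lemma path_value_unique x y (p : PathSpace x y) c c' :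
  path_value p c -> path_value p c' -> c = c'.
Proof.
move=> pc [L [hL L0 L1]]; have := path_value_lift_eq pc hL L0.
by rewrite L1 => -[].
Qed.

(** Lifts are chosen along every stage [Q t] of the homotopy. All stages end at [y], so their final
    values are compared in the one chart [inl y], where they are locally constant in [t]. *)
Lemma path_value_homotopic x y (p q : PathSpace x y) c c' :
  path_homotopic d0 d1 x y (pval p) (pval q) ->
  path_value p c -> path_value q c' -> c = c'.
Proof.
move=> [K [cK [Kp [Kq [Kx Ky]]]]] pc qc'.
pose Q (t s : R) : X := K (projI s, projI t).
have cQ : continuous (fun z : R * R => Q z.1 z.2).
  apply: (continuous_compose (g := K)) => //; apply: continuous_pair.
    by apply: continuous_compose (@projI_continuous R) => ?; exact: cvg_snd.
  by apply: continuous_compose (@projI_continuous R) => ?; exact: cvg_fst.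
have cQ1 t : continuous (Q t).
  apply: (continuous_compose (f := fun s => (t, s)) (g := fun z : R * R => Q z.1 z.2)) => //.
  by apply: continuous_pair; [exact: continuous_cst|move=> ?; exact: cvg_id].
have cQ2 s : continuous (Q^~ s).
  apply: (continuous_compose (f := fun t => (t, s)) (g := fun z : R * R => Q z.1 z.2)) => //.
  by apply: continuous_pair; [move=> ?; exact: cvg_id|exact: continuous_cst].
have Q0 t : Q t 0 = inl x by rewrite /Q projI0 // Kx.
have Q1 t : Q t 1 = inl y by rewrite /Q projI1 // Ky.
have exL t : exists L : R -> forall K : chart_index V, option (hom (f0 x) (f0 (chart_base K))),
    lift (Q t) L 0 1 /\ L 0 (inl x) = Some (tg_id (f0 x)).
  have [|L ? ?] := @lift_ex (Q t) 0 1 (f0 x) (inl x) (tg_id (f0 x)) (cQ1 t) ler01.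
    by rewrite Q0.
  by exists L.
pose L t := projT1 (cid (exL t)).
have hL t : lift (Q t) (L t) 0 1 by rewrite /L; case: cid => ? [].
have L0 t : L t 0 (inl x) = Some (tg_id (f0 x)) by rewrite /L; case: cid => ? [].
have : L 1 1 (inl y) = L 0 1 (inl y).
  apply: (@segment_ind R (fun t => L t 1 (inl y) = L 0 1 (inl y)) 0 1) => // t0 _.
  suff hn : \forall t \near t0, L t 1 (inl y) = L t0 1 (inl y).
    by apply: filterS hn => t ->.
  apply: (@lift_parameter R X H (chart_index V) (fun K => f0 (chart_base K)) chart
    (transition f) _ _ _ (nbhs t0) t0 Q (f0 x) L 0 1 (inl x)
    (fun y z (a : R -> option (hom y z)) => \forall t \near t0, a t = a t0)) => //.
  - exact: chart_open.
  - exact: chart_cover.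
  - move=> ? ? a b ab ha; have e := nbhs_singleton ab.
    by apply: filterS2 ab ha => t /= <- ->.
  - by move=> ? ? ? a b ha hb; apply: filterS2 ha hb => t /= -> ->.
  - move=> r K' r01 K'r.
    (* A product neighborhood inside the preimage of the chart gives the tube. *)
    have : nbhs (t0, r) ((fun z : R * R => Q z.1 z.2) @^-1` chart K').
      by apply: cQ; apply: open_nbhs_nbhs; split; [exact: chart_open|].
    move=> [[A B] /= [At Br] AB].
    apply: filterS (near_between Br) => r' hr' _; apply: filterS At => t At z hz.
    exact: (AB (t, z) (conj At (hr' z hz))).
  - by move=> r K' M _ K'r Mr; exact: (transition_near f (cQ2 r)).
  - by rewrite Q0.
  - by apply: filterS filterT => t _; rewrite !L0.
  - by rewrite Q1.
have -> : L 1 1 (inl y) = Some c'.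
  apply: (path_value_lift_eq qc') (L0 1); apply: lift_ext (hL 1) => r _.
  by rewrite /Q (@projI1 R 1) // Kq.
have -> : L 0 1 (inl y) = Some c.
  apply: (path_value_lift_eq pc) (L0 0); apply: lift_ext (hL 0) => r _.
  by rewrite /Q (@projI0 R 0) // Kp.
by case.
Qed.

(** By uniqueness, the lift along [r] is a rescaled lift of [p] on the first half and [c] times a
    rescaled lift of [q] on the second. *)
Lemma path_value_concat x y z (p : PathSpace x y) (q : PathSpace y z) (r : PathSpace x z) c c' :
  (forall t, pval r t = concat (pval p) (pval q) t) ->
  path_value p c -> path_value q c' -> path_value r (tg_comp c c').
Proof.
move=> rpq [Lp [hLp Lp0 Lp1]] [Lq [hLq Lq0 Lq1]].
have [d rd] := path_value_exists r; suff <- : d = tg_comp c c' by [].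
have [L [hL L0 L1]] := rd.
have half01 : 0 <= (2^-1 : R) <= 1 by apply/andP; split; lra.
have /andP[half0 half1] := half01.
have rE s : 0 <= s <= 1 -> rpath r s =
    if s <= 2^-1 then rpath p (2 * s) else rpath q (2 * s - 1).
  by move=> s01; rewrite {1}/rpath rpq concatE projI_val.
have e2 : 2 * 2^-1 = 1 :> R by lra.
have rhalf : rpath r 2^-1 = inl y by rewrite rE // lexx e2 rpath_ge1.
have cmul : continuous (fun s : R => 2 * s).
  by apply: continuous_mulR; [exact: continuous_cst|move=> ?; exact: cvg_id].
have cr := @rpath_continuous R V E d0 d1 _ _ r.
have Lhalf : L 2^-1 (inl y) = Some c.
  pose L' (s : R) (K : chart_index V) := ocomp (Some (tg_id (f0 x))) (Lp (2 * s) K).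
  have hL' : lift (rpath r) L' 0 2^-1.
    have h : lift (rpath p \o (fun s => 2 * s)) L' 0 2^-1.
      by apply: lift_comp hLp => // s /andP[? ?]; apply/andP; split; lra.
    apply: lift_ext h => s /andP[s0 s1] /=.
    by rewrite rE ?s1 // s0 (le_trans s1).
  have -> : L 2^-1 (inl y) = L' 2^-1 (inl y).
    have hL2 : lift (rpath r) L 0 2^-1 by exact: lift_sub hL.
    apply: lift_uniq hL2 hL' (chart_rpath0 r) _ _ _ => //.
      by rewrite L0 /L' mulr0 Lp0 /= tg_id_l.
    by rewrite rhalf.
  by rewrite /L' e2 Lp1 ocomp1l.
pose L' (s : R) (K : chart_index V) := ocomp (Some c) (Lq (2 * s - 1) K).
have hL' : lift (rpath r) L' 2^-1 1.
  have h : lift (rpath q \o (fun s => 2 * s - 1)) L' 2^-1 1.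
    apply: lift_comp hLq; first by apply: continuous_subR => //; exact: continuous_cst.
    by move=> s /andP[? ?]; apply/andP; split; lra.
  apply: lift_ext h => s /andP[s0 s1] /=.
  rewrite rE ?s1 ?(le_trans half0) //; case: ifP => // s2.
  have -> : s = 2^-1 by apply/eqP; rewrite eq_le s0 s2.
  by rewrite e2 subrr rpath_le0 // rpath_ge1.
have hL2 : lift (rpath r) L 2^-1 1 by exact: lift_sub hL.
have : L 1 (inl z) = L' 1 (inl z).
  apply: (@lift_uniq _ _ _ _ _ _ (inl y) cr half1 hL2 hL' _ _ _ (chart_rpath1 r)).
    by rewrite rhalf.
  by rewrite Lhalf /L' e2 subrr Lq0 /= tg_id_r.
have e1 : 2 * 1 - 1 = 1 :> R by lra.
by rewrite L1 /L' e1 Lq1 => -[].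
Qed.

(** The lift of [p] run backwards starts at [c]; composition with the inverse of [c] on the left
    makes it start at the identity. *)
Lemma path_value_reverse x y (p : PathSpace x y) (r : PathSpace y x) c :
  (forall t, pval r t = reverse (pval p) t) ->
  path_value p c -> path_value r (tg_inv c).
Proof.
move=> rp [Lp [hLp Lp0 Lp1]].
have [d rd] := path_value_exists r; suff <- : d = tg_inv c by [].
pose L' (s : R) (K : chart_index V) := ocomp (Some (tg_inv c)) (Lp (1 - s) K).
have hL' : lift (rpath r) L' 0 1.
  have h : lift (rpath p \o (fun s => 1 - s)) L' 0 1.
    apply: lift_comp hLp.
      by apply: continuous_subR; [exact: continuous_cst|move=> ?; exact: cvg_id].
    by move=> s /andP[? ?]; apply/andP; split; lra.
  by apply: lift_ext h => s s01 /=; rewrite [RHS]/rpath rp reverseE projI_val.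
have := path_value_lift_eq rd hL'.
rewrite /L' subr0 subrr Lp0 Lp1 /= tg_inv_l tg_id_r => /(_ erefl).
by case.
Qed.

Lemma path_value_const x (p : PathSpace x x) :
  (forall t, pval p t = inl x) -> path_value p (tg_id (f0 x)).
Proof.
move=> px; have [L hL L0] := path_value_lift p; exists L; split=> //.
rewrite -L0; apply: lift_const hL _ => // r _.
by rewrite /rpath px.
Qed.

Lemma path_value_edge x y (e : Gxy d0 d1 x y) (p : PathSpace x y) :
  (forall t, pval p t = alpha d0 d1 (val e) t) -> path_value p (f (pi0_class R e)).
Proof.
move=> pe; have [L hL L0] := path_value_lift p; exists L; split=> //.
have pE r : rpath p r = edgept d0 d1 (val e) r by rewrite /rpath pe.
have [e0 e1] := GxyP e.
have q0 : 0 <= (4^-1 : R) by lra.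
have q1 : (4^-1 : R) <= 3 * 4^-1 by lra.
have q2 : 3 * (4^-1 : R) <= 1 by lra.
have in0 r : 0 <= r <= 4^-1 -> chart (inl x) (rpath p r).
  move=> /andP[_ r4]; rewrite pE; case: edgeptP => [_ //|r1|t tr _] /=.
    by exfalso; move: r4 r1; lra.
  by left; split=> //; rewrite tr; apply: le_lt_trans r4 _; lra.
have in1 r : 4^-1 <= r <= 3 * 4^-1 -> chart (inr (x, y)) (rpath p r).
  move=> /andP[r0 r1]; rewrite pE; case: edgeptP => [h|h|t _ _] //.
    by exfalso; move: r0 h; lra.
  by exfalso; move: r1 h; lra.
have in2 r : 3 * 4^-1 <= r <= 1 -> chart (inl y) (rpath p r).
  move=> /andP[r4 _]; rewrite pE; case: edgeptP => [r1|_ //|t tr _] /=.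
    by exfalso; move: r4 r1; lra.
  by right; split=> //; rewrite tr; apply: lt_le_trans r4; lra.
have hL0 : lift (rpath p) L 0 4^-1 by apply: lift_sub hL => //; lra.
have hL1 : lift (rpath p) L 4^-1 (3 * 4^-1) by apply: lift_sub hL.
have hL2 : lift (rpath p) L (3 * 4^-1) 1 by apply: lift_sub hL => //; lra.
have Lq : L 4^-1 (inl x) = Some (tg_id (f0 x)).
  by rewrite -L0; exact: lift_const q0 hL0 in0.
have Lq' : L 4^-1 (inr (x, y)) = Some (tg_id (f0 x)).
  have [|_ h _] := hL 4^-1; first by apply/andP; split; lra.
  rewrite (h (inl x)); [|by apply: in0; rewrite q0 lexx|by apply: in1; rewrite q1 lexx].
  have [|t tq et] := @edgept_mid R V E d0 d1 (val e) 4^-1.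
    by apply/andP; split; lra.
  rewrite Lq pE et /= tq ifT; last by lra.
  (* Entering the edge chart uses the inverse of the identity, which is rewritten to the
     identity. *)
  by rewrite oidE /= tg_id_l -[in LHS](tg_id_l (tg_inv _)) tg_inv_r.
have L3 : L (3 * 4^-1) (inr (x, y)) = Some (tg_id (f0 x)).
  by rewrite -Lq'; exact: lift_const q1 hL1 in1.
have L3' : L (3 * 4^-1) (inl y) = Some (f (pi0_class R e)).
  have [|_ h _] := hL (3 * 4^-1); first by apply/andP; split; lra.
  rewrite (h (inr (x, y))); [|by apply: in1; rewrite q1 lexx|by apply: in2; rewrite q2 lexx].
  have [|t tq et] := @edgept_mid R V E d0 d1 (val e) (3 * 4^-1).
    by apply/andP; split; lra.
  rewrite L3 pE et /transition leave_edge_gt // ?oidE /= ?tg_id_l ?tg_id_r //.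
  by rewrite tq; lra.
by rewrite -L3'; exact: lift_const q2 hL2 in2.
Qed.

(** The condition on [q] is a subbasic open set of the compact-open topology. *)
Lemma near_path_compact x y (p : PathSpace x y) (K : set I01) (O : set X) :
  compact K -> open O -> (forall t, K t -> O (pval p t)) ->
  \forall q \near p, forall t, K t -> O (pval q t).
Proof.
move=> cK oO hp.
have oKO := compact_open_open cK oO.
have hn : nbhs (val p) [set g : @compact_open I01 X | g @` K `<=` O].
  by apply: open_nbhs_nbhs; split=> // _ [t Kt <-]; exact: hp.
have : nbhs p (val @^-1` [set g : @compact_open I01 X | g @` K `<=` O]).
  exact: (@subtype_val_continuous _ (@is_path R V E d0 d1 x y)).
by apply: filterS => q /= hq t Kt; apply: hq; exists t.
Qed.

Hypothesis f_cont : forall x y (W : set (hom (f0 x) (f0 y))),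
  open W -> pi0_open (f (x:=x) (y:=y) @^-1` W).

(** An instance of [lift_parameter] with the path space as parameter space and continuity at [p] as
    the propagated property. *)
Lemma path_value_continuous x y (p : PathSpace x y) c (W : set (hom (f0 x) (f0 y))) :
  path_value p c -> nbhs c W -> \forall q \near p, exists2 c', path_value q c' & W c'.
Proof.
move=> pc Wc.
have exL q : exists L : R -> forall K : chart_index V, option (hom (f0 x) (f0 (chart_base K))),
    lift (rpath (q : PathSpace x y)) L 0 1 /\ L 0 (inl x) = Some (tg_id (f0 x)).
  by have [L ? ?] := path_value_lift q; exists L.
pose L q := projT1 (cid (exL q)).
have hL q : lift (rpath q) (L q) 0 1 by rewrite /L; case: cid => ? [].
have L0 q : L q 0 (inl x) = Some (tg_id (f0 x)) by rewrite /L; case: cid => ? [].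
suff [c0 Lc0 h] : ocont (nbhs p) p (fun q => L q 1 (inl y)).
  have ec : c0 = c.
    by have := path_value_lift_eq pc (hL p) (L0 p); rewrite Lc0 => -[].
  subst c0; apply: filterS (h W Wc) => q /= [c' Lc' Wc'].
  have [c'' qc'' Lc''] := path_value_of (hL q) (L0 q).
  by exists c'' => //; move: Lc''; rewrite Lc' => -[<-].
apply: (@lift_parameter R X H (chart_index V) (fun K => f0 (chart_base K)) chart
    (transition f) _ _ _ (nbhs p) p (fun q => rpath q) (f0 x) L 0 1 (inl x)
    (fun y z a => ocont (nbhs p) p a)) => //.
- exact: chart_open.
- exact: chart_cover.
- by move=> ? ? a b ab; apply: ocont_near => //; exact: nbhs_singleton ab.
- by move=> ? ? ? a b; exact: ocont_comp.
- exact: rpath_continuous.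
- move=> r K r01 Kr.
  have hn : nbhs r (rpath p @^-1` chart K).
    by apply: rpath_continuous; apply: open_nbhs_nbhs; split; [exact: chart_open|].
  apply: filterS (near_between hn) => r' hr' _.
  (* Compactness of the set of times between [r] and [r'] makes the tube a compact-open neighborhood
     of [p]. *)
  have cK : compact (@projI R @` `[Num.min r r', Num.max r r']).
    apply: continuous_compact; last exact: segment_compact.
    by apply: continuous_subspaceT; exact: projI_continuous.
  have hq : \forall q \near p, forall t, (@projI R @` `[Num.min r r', Num.max r r']) t ->
      chart K (pval q t).
    apply: near_path_compact cK (chart_open R d0 d1 K) _ => _ [z + <-].
    by rewrite /= in_itv; exact: hr'.
  apply: filterS hq => q hq z hz; apply: hq; exists z => //.
- move=> r K M _ Kr Mr.
  apply: (@ocont_compose _ _ _ _ _ _ _ (nbhs p) p (fun q => rpath q r)).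
    move=> W'; rewrite nbhsE => -[O [oO Or] sW].
    have hq : \forall q \near p, forall t, [set projI r] t -> O (pval q t).
      by apply: near_path_compact (@compact_set1 _ _) oO _ => _ ->.
    by apply: filterS hq => q hq; apply: sW; exact: hq.
  exact: transition_cont.
- have c0 := @ocont_cst _ _ (nbhs p) p _ _ (tg_id (f0 x)) _.
  apply: ocont_near (c0 _); first by rewrite L0.
  by apply: filterS filterT => q _ /=; rewrite L0.
Qed.

End PathValue.

(** * Continuity of the edge class map, and the functor induced by a morphism *)

Section Freeness.
Variables (R : realType) (V : Type) (E : topologicalType) (d0 d1 : E -> V).
Hypothesis hd0 : forall v : V, open (d0 @^-1` [set v]).
Hypothesis hd1 : forall v : V, open (d1 @^-1` [set v]).
Local Notation X :=
  (Defs_realization__canonical__topology_structure_Topological R d0 d1).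
Local Notation I01 := (unit_interval R).
Local Notation chart := (@chart R V E d0 d1).
Local Notation PathSpace := (PathSpace R d0 d1).
Local Notation PiHom := (PiHom R d0 d1).

Lemma alpha_continuous : continuous (fun z : E * I01 => alpha d0 d1 z.1 z.2 : X).
Proof.
have -> : (fun z : E * I01 => alpha d0 d1 z.1 z.2 : X) =
    (fun z : E * I01 => edgept d0 d1 z.1 (val z.2)).
  by apply/funext => z; rewrite alphaE.
apply: edgept_continuous => //; first by move=> ?; exact: cvg_fst.
by apply: continuous_compose (@unit_interval_val_continuous R) => ?; exact: cvg_snd.
Qed.

Lemma Gxy_alpha_continuous x y :
  continuous (fun z : Gxy d0 d1 x y * I01 => alpha d0 d1 (val z.1) z.2 : X).
Proof.
apply: (continuous_compose (f := fun z : Gxy d0 d1 x y * I01 => (val z.1, z.2))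
  (g := fun z : E * I01 => alpha d0 d1 z.1 z.2 : X)); last exact: alpha_continuous.
apply: continuous_pair; last by move=> ?; exact: cvg_snd.
by apply: continuous_compose (@subtype_val_continuous _ _) => ?; exact: cvg_fst.
Qed.

Lemma alpha_path x y (e : Gxy d0 d1 x y) :
  exists p : PathSpace x y, forall t, pval p t = alpha d0 d1 (val e) t.
Proof.
have [e0 e1] := GxyP e.
have [||| p pE] := @path_of R V E d0 d1 x y (alpha d0 d1 (val e)).
- apply: (continuous_compose (f := fun t => (e, t))
    (g := fun z : Gxy d0 d1 x y * I01 => alpha d0 d1 (val z.1) z.2 : X)).
    by apply: continuous_pair; [exact: continuous_cst|move=> ?; exact: cvg_id].
  exact: Gxy_alpha_continuous.
- by rewrite alphaE edgept_le0 // e0.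
- by rewrite alphaE edgept_ge1 // e1.
by exists p => t; rewrite pE.
Qed.

Definition edge_path x y (e : Gxy d0 d1 x y) : PathSpace x y :=
  projT1 (cid (alpha_path e)).

Lemma edge_pathE x y (e : Gxy d0 d1 x y) t : pval (edge_path e) t = alpha d0 d1 (val e) t.
Proof. by rewrite /edge_path; case: cid. Qed.

(** Currying turns the joint continuity of [alpha] into continuity for the compact-open topology. *)
Lemma edge_path_continuous x y : continuous (@edge_path x y).
Proof.
apply: continuous_to_subtype => e.
have -> : (fun e => val (edge_path e)) =
    (curry (fun z : Gxy d0 d1 x y * I01 => alpha d0 d1 (val z.1) z.2 : X)).
  by apply/funext => e'; apply/funext => t; exact: edge_pathE.
by have [h _] := continuous_curry (@Gxy_alpha_continuous x y); exact: h.
Qed.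

Lemma edge_path_homotopic x y (e e' : Gxy d0 d1 x y) :
  path_comp R e e' -> pi_class (edge_path e) = pi_class (edge_path e').
Proof.
move=> [g [cg [g0 g1]]]; apply: pi_class_eq.
exists (fun z => alpha d0 d1 (val (g z.2)) z.1); split.
  apply: (continuous_compose (f := fun z => (g z.2, z.1))
    (g := fun z : Gxy d0 d1 x y * I01 => alpha d0 d1 (val z.1) z.2 : X)).
    apply: continuous_pair; last by move=> ?; exact: cvg_fst.
    by apply: continuous_compose cg => ?; exact: cvg_snd.
  exact: Gxy_alpha_continuous.
split=> [s|]; first by rewrite g0 edge_pathE.
split=> [s|]; first by rewrite g1 edge_pathE.
by split=> t; have [e0 e1] := GxyP (g t); rewrite alphaE;
  [rewrite edgept_le0 // e0|rewrite edgept_ge1 // e1].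
Qed.

(** The relation [jmap] is the graph of a map: a path of edges is a homotopy between edge paths. *)
Lemma jmapP x y (e : Gxy d0 d1 x y) a :
  jmap (pi0_class R e) a <-> a = pi_class (edge_path e).
Proof.
split=> [[e' [p [ee' [ap pe]]]]|->].
  rewrite (pi_class_sval ap).
  have -> : p = edge_path e' by apply: pval_inj => t; rewrite pe edge_pathE.
  by apply: edge_path_homotopic; exact: pi0_class_path.
exists e, (edge_path e); split=> //; split; first exact: sval_pi_class.
exact: edge_pathE.
Qed.

(** Open sets of the reflection are open for the quotient topology, and [edge_path] pulls the latter
    back to open sets of edges. *)
Lemma tau_open_pi0 x y (W : set (PiHom x y)) : tau_open W ->
  pi0_open [set c | exists a, jmap c a /\ W a].
Proof.
move=> [O [_ [Oq OW]]]; have oW := Oq _ _ _ OW.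
have -> : [set c | exists a, jmap c a /\ W a] =
    (fun c => exists2 e, c = pi0_class R e & W (pi_class (@edge_path x y e))).
  apply/seteqP; split=> c /=.
    move=> [a [ja Wa]]; have [e [_ [ce _]]] := ja; subst c.
    by move/jmapP : ja Wa => ->; exists e.
  by move=> [e -> We]; exists (pi_class (edge_path e)); split=> //; apply/jmapP.
rewrite /pi0_open.
have -> : @pi0_class R V E d0 d1 x y @^-1`
    (fun c => exists2 e, c = pi0_class R e & W (pi_class (@edge_path x y e))) =
    @edge_path x y @^-1` (@pi_class R V E d0 d1 x y @^-1` W).
  apply/seteqP; split=> e /=; last by exists e.
  by move=> [e' ee']; rewrite (edge_path_homotopic (pi0_class_path ee')).
by apply: open_comp => // z _; exact: edge_path_continuous.
Qed.

Variables (H : TopGroupoid) (f0 : V -> tg_ob H).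
Local Notation hom := (@tg_hom H).
Variable f : forall x y, Pi0 R d0 d1 x y -> hom (f0 x) (f0 y).
Local Notation path_value := (path_value f).

Lemma class_value_exists x y (a : PiHom x y) :
  exists c, forall p, sval a p -> path_value p c.
Proof.
have [p ->] := pi_class_surj a; have [c pc] := path_value_exists f p.
exists c => q pq; have [c' qc'] := path_value_exists f q.
by rewrite (path_value_homotopic pq pc qc').
Qed.

Definition class_value x y (a : PiHom x y) : hom (f0 x) (f0 y) :=
  projT1 (cid (class_value_exists a)).

Lemma class_valueP x y (a : PiHom x y) p : sval a p -> path_value p (class_value a).
Proof. by rewrite /class_value; case: cid => c /= h /h. Qed.

Lemma class_value_functor : pi_functor class_value.
Proof.
split=> [x y z a b c [p [q [r [ap [bq [cr rE]]]]]]|x a [p [ap pE]]].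
  apply: (path_value_unique (class_valueP cr)).
  exact: path_value_concat rE (class_valueP ap) (class_valueP bq).
apply: (path_value_unique (class_valueP ap)).
exact: path_value_const.
Qed.

Lemma class_value_inv x y (a : PiHom x y) c : Defs.pi_inv a c ->
  class_value c = tg_inv (class_value a).
Proof.
move=> [p [r [ap [cr rE]]]].
apply: (path_value_unique (class_valueP cr)).
exact: path_value_reverse rE (class_valueP ap).
Qed.

Lemma class_value_factors : factors_through_j f class_value.
Proof.
move=> x y c a [e [p [<- [ap pE]]]].
apply: (path_value_unique (class_valueP ap)).
exact: path_value_edge.
Qed.

Hypothesis f_cont : forall x y (W : set (hom (f0 x) (f0 y))),
  open W -> pi0_open (f (x:=x) (y:=y) @^-1` W).

Lemma class_value_qtop x y (W : set (hom (f0 x) (f0 y))) : open W ->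
  qtop_open (@class_value x y @^-1` W).
Proof.
move=> oW; rewrite /qtop_open openE => p Wp; rewrite /interior.
have Wn : nbhs (class_value (pi_class p)) W by exact: open_nbhs_nbhs.
have pv := class_valueP (sval_pi_class p).
apply: filterS (path_value_continuous f_cont pv Wn) => q [c qc Wc] /=.
by rewrite (path_value_unique (class_valueP (sval_pi_class q)) qc).
Qed.

(** The witness is the topology pulled back from [H] along [class_value]. It is a Top-groupoid
    topology because [class_value] respects composition and inversion, and it is coarser than the
    quotient topology by [class_value_qtop]. *)
Lemma class_value_tau : pi_tau_continuous class_value.
Proof.
move=> x y W oW.
pose O x y (B : set (PiHom x y)) := exists2 W, open W & B = @class_value x y @^-1` W.
exists O; split; last by split; [move=> ? ? _ [W' oW' ->]; exact: class_value_qtop|exists W].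
split=> [x' y'|].
  split; first by exists setT; [exact: openT|].
  split=> [_ _ [A oA ->] [B oB ->]|I F hF].
    by exists (A `&` B); [exact: openI|].
  pose G i := projT1 (cid2 (hF i)).
  exists (\bigcup_i G i).
    by apply: bigcup_open => i _; rewrite /G; case: cid2.
  apply/seteqP; split=> a [i _ Fa]; exists i => //; move: Fa; rewrite /G.
    by case: cid2 => /= B _ ->.
  by case: cid2 => /= B _ ->.
split=> [x' y' z' W' a b c [A oA ->] abc /= Ac|x' y' W' a c [A oA ->] ac /= Ac].
  have [hc _] := class_value_functor; rewrite (hc _ _ _ _ _ _ abc) in Ac.
  have := @tg_comp_cont H _ _ _ (class_value a, class_value b) A
    (open_nbhs_nbhs (conj oA Ac)).
  move=> [[B B'] /= []]; rewrite !nbhsE => -[C [oC Ca CB]] [C' [oC' Cb CB']] BB'.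
  exists (@class_value _ _ @^-1` C), (@class_value _ _ @^-1` C').
  split; first by exists C.
  split; first by exists C'.
  do 2!split=> //; move=> a' b' c' /= Ca' Cb' abc'.
  rewrite (hc _ _ _ _ _ _ abc').
  by apply: (BB' (class_value a', class_value b')); split; [exact: CB|exact: CB'].
exists (@class_value _ _ @^-1` (@tg_inv H _ _ @^-1` A)).
split.
  by eexists; last reflexivity; apply: open_comp => // ? _; exact: tg_inv_cont.
split; first by rewrite /= -(class_value_inv ac).
by move=> a' c' /= Aa' /class_value_inv ->.
Qed.

End Freeness.

(** * Uniqueness of the extension *)

Section Uniqueness.
Variables (R : realType) (V : Type) (E : topologicalType) (d0 d1 : E -> V).
Hypothesis hd0 : forall v : V, open (d0 @^-1` [set v]).
Hypothesis hd1 : forall v : V, open (d1 @^-1` [set v]).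
Local Notation X :=
  (Defs_realization__canonical__topology_structure_Topological R d0 d1).
Local Notation I01 := (unit_interval R).
Local Notation chart := (@chart R V E d0 d1).
Local Notation PathSpace := (PathSpace R d0 d1).
Local Notation PiHom := (PiHom R d0 d1).
Variables (H : TopGroupoid) (f0 : V -> tg_ob H).
Local Notation hom := (@tg_hom H).
Variable f : forall x y, Pi0 R d0 d1 x y -> hom (f0 x) (f0 y).
Variable G : forall x y, PiHom x y -> hom (f0 x) (f0 y).
Hypothesis G_functor : pi_functor G.
Hypothesis G_factors : factors_through_j f G.
Variables (x0 y0 : V) (p : PathSpace x0 y0).

(** A clock that rests at 0 until time 1/2 and then runs to 1; it drives the contraction in a
    closed-up path. *)
Let ramp (r : R) : R := val (projI (2 * r - 1)).

Let ramp01 r : 0 <= ramp r <= 1. Proof. exact: unit_intervalP. Qed.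

Let cmul (c : R) : continuous (fun r : R => c * r).
Proof. by apply: continuous_mulR; [exact: continuous_cst|move=> ?; exact: cvg_id]. Qed.

Let ramp_continuous : continuous ramp.
Proof.
apply: (continuous_compose (g := fun t : I01 => val t));
  last exact: unit_interval_val_continuous.
apply: continuous_compose (@projI_continuous R).
by apply: continuous_subR; [exact: cmul|exact: continuous_cst].
Qed.

Let ramp_half : ramp 2^-1 = 0.
Proof. by rewrite /ramp projI0 //; lra. Qed.

Let ramp1 : ramp 1 = 1.
Proof. by rewrite /ramp projI1 //; lra. Qed.

Let rampE r : 2^-1 <= r <= 1 -> ramp r = 2 * r - 1.
Proof. by move=> /andP[? ?]; rewrite /ramp projI_val //; apply/andP; split; lra. Qed.

(* The initial segment of [p] up to time [s], followed by the contraction of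
   the chart [K] to its base vertex. *)
Definition closed_up (s : R) (K : chart_index V) (r : R) : X :=
  if r <= 2^-1 then rpath p (2 * r * s) else contract K (rpath p s) (ramp r).

Let contract_continuous (T : topologicalType) K (u : T -> X) (r : T -> R) :
  continuous u -> continuous r -> (forall t, chart K (u t)) ->
  (forall t, 0 <= r t <= 1) -> continuous (fun t => contract K (u t) (r t)).
Proof. by move=> cu cr hu r01 t; apply: contract_cvg => //; [exact: cu|exact: cr]. Qed.

Let rpath_cont (T : topologicalType) (h : T -> R) :
  continuous h -> continuous (fun t => rpath p (h t)).
Proof. by move=> ch; apply: continuous_compose (@rpath_continuous _ _ _ _ _ _ _ p). Qed.

Lemma closed_up_path s K : chart K (rpath p s) ->
  exists q : PathSpace x0 (chart_base K), forall t, pval q t = closed_up s K (val t).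
Proof.
move=> Ks; apply: path_ofR.
- apply: continuous_glue.
  + apply: rpath_cont; apply: continuous_mulR; last exact: continuous_cst.
    exact: cmul.
  + by apply: contract_continuous => //; exact: continuous_cst.
  + by move=> ?; exact: cvg_id.
  + move=> r ->; rewrite ramp_half contract0; congr rpath; lra.
- by rewrite /closed_up ifT ?rpath_le0 //; lra.
- rewrite /closed_up ifF; first by rewrite ramp1 contract1.
  by apply/negbTE; rewrite -ltNge; lra.
Qed.

(** [None] can occur only when [rpath p s] lies outside [K]. A path is determined by its values, so
    the result does not depend on the choice. *)
Definition closed_up_value (s : R) (K : chart_index V) :
    option (hom (f0 x0) (f0 (chart_base K))) :=
  if pselect (exists q : PathSpace x0 (chart_base K),
    forall t, pval q t = closed_up s K (val t)) is left h
  then Some (G (pi_class (projT1 (cid h)))) else None.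

Lemma closed_up_valueE s K (q : PathSpace x0 (chart_base K)) :
  (forall t, pval q t = closed_up s K (val t)) ->
  closed_up_value s K = Some (G (pi_class q)).
Proof.
move=> hq; rewrite /closed_up_value; case: pselect => [h|]; last by case; exists q.
case: cid => q' /= hq'; congr (Some (G (pi_class _))).
by apply: pval_inj => t; rewrite hq hq'.
Qed.

Let pi_comp_class x y z (q : PathSpace x y) (q' : PathSpace y z) (r : PathSpace x z) :
  (forall t, pval r t = concat (pval q) (pval q') t) ->
  G (pi_class r) = tg_comp (G (pi_class q)) (G (pi_class q')).
Proof.
move=> rE; have [h _] := G_functor; apply: h; exists q, q', r.
by do 2?(split; first exact: sval_pi_class); split=> //; exact: sval_pi_class.
Qed.

Let pi_class_const x (q : PathSpace x x) : (forall t, pval q t = inl x) ->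
  G (pi_class q) = tg_id (f0 x).
Proof.
move=> qE; have [_ h] := G_functor; apply: h; exists q; split=> //.
exact: sval_pi_class.
Qed.

(** Moving the stopping time within one chart is a homotopy with fixed ends, since the contraction
    always finishes at the base vertex. *)
Lemma closed_up_value_near s K : chart K (rpath p s) ->
  \forall s' \near s, closed_up_value s' K = closed_up_value s K.
Proof.
move=> Ks; have hn : nbhs s (rpath p @^-1` chart K).
  by apply: rpath_continuous; apply: open_nbhs_nbhs; split; [exact: chart_open|].
apply: filterS (near_between hn) => s' hs'.
have Ks' : chart K (rpath p s').
  by apply: hs'; rewrite ge_min le_max lexx !orbT.
have [q qE] := closed_up_path Ks; have [q' q'E] := closed_up_path Ks'.
rewrite (closed_up_valueE qE) (closed_up_valueE q'E); congr (Some (G _)).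
(* The stopping time moves from [s] to [s'] and stays between them, hence in the chart. *)
pose sg (t : R) := s + val (projI t) * (s' - s).
have csg : continuous sg.
  apply: continuous_addR; first exact: continuous_cst.
  apply: continuous_mulR; last exact: continuous_cst.
  apply: continuous_compose (@unit_interval_val_continuous R).
  exact: projI_continuous.
have Ksg t : chart K (rpath p (sg t)).
  apply: hs'; rewrite /sg; have /andP[t0 t1] := unit_intervalP (projI t).
  by case: (leP s s') => ss'; apply/andP; split; nra.
have sg0 : sg 0 = s by rewrite /sg projI0 //= mul0r addr0.
have sg1 : sg 1 = s' by rewrite /sg projI1 //= mul1r addrC subrK.
apply/esym; apply: (pi_class_eqR (H := fun z : R * R => closed_up (sg z.2) K z.1)).
- apply: continuous_glue.
  + apply: rpath_cont; apply: continuous_mulR.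
      by apply: continuous_mulR; [exact: continuous_cst|move=> ?; exact: cvg_fst].
    by apply: continuous_compose csg => ?; exact: cvg_snd.
  + apply: contract_continuous => //.
      by apply: rpath_cont; apply: continuous_compose csg => ?; exact: cvg_snd.
    by apply: continuous_compose ramp_continuous => ?; exact: cvg_fst.
  + by move=> ?; exact: cvg_fst.
  + move=> [r t] /= ->; rewrite ramp_half contract0; congr rpath; lra.
- by move=> r r01; rewrite /= sg0 /rpath qE projI_val.
- by move=> r r01; rewrite /= sg1 /rpath q'E projI_val.
- by move=> t _; rewrite /= /closed_up ifT ?rpath_le0 //; lra.
- move=> t _; rewrite /= /closed_up ifF; first by rewrite ramp1 contract1.
  by apply/negbTE; rewrite -ltNge; lra.
Qed.

(** Closing up in the edge chart returns to the source, in the star it goes on to the target; the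
    two differ by the whole edge, on which [G] is [f [e]]. *)
Lemma closed_up_past_half s x y (e : Gxy d0 d1 x y) (t : open01 R)
    (q : PathSpace x0 x) (q' : PathSpace x0 y) :
  rpath p s = inr (val e, t) -> 2^-1 < oval t ->
  (forall t, pval q t = closed_up s (inr (x, y)) (val t)) ->
  (forall t, pval q' t = closed_up s (inl y) (val t)) ->
  G (pi_class q') = tg_comp (G (pi_class q)) (f (pi0_class R e)).
Proof.
move=> ps ht qE q'E; have [e0 e1] := GxyP e.
(* A constant path is appended to [q'] so that both sides are concatenations on the same time
   scale. *)
have [k kE] := @const_path R V E d0 d1 y.
have [c cE] := concat_path q (edge_path R hd0 hd1 e).
have [c' c'E] := concat_path q' k.
have -> : f (pi0_class R e) = G (pi_class (edge_path R hd0 hd1 e)).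
  by apply/esym/G_factors/jmapP.
rewrite -(pi_comp_class cE) -[LHS]tg_id_r -(pi_class_const kE) -(pi_comp_class c'E).
congr G; apply/esym.
(* Homotopy through detours via the point [z.2] of the edge: for [z.2 = 0] the
   path runs back to the source and then along the whole edge, for [z.2 = 1] it
   runs directly to the target. *)
pose m (z : R * R) := if z.1 <= 2^-1
  then oval t + ramp (2 * z.1) * (z.2 - oval t) else z.2 + ramp z.1 * (1 - z.2).
have cfst : continuous (fun z : R * R => z.1) by move=> ?; exact: cvg_fst.
have csnd : continuous (fun z : R * R => z.2) by move=> ?; exact: cvg_snd.
have e22 : 2 * 2^-1 = 1 :> R by lra.
have cm : continuous m.
  apply: continuous_glue => //.
  - apply: continuous_addR; first exact: continuous_cst.
    apply: continuous_mulR; last by apply: continuous_subR => //; exact: continuous_cst.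
    by apply: continuous_compose ramp_continuous; exact: continuous_compose (@cmul 2).
  - apply: continuous_addR => //; apply: continuous_mulR.
      exact: continuous_compose ramp_continuous.
    by apply: continuous_subR => //; exact: continuous_cst.
  - by move=> [r w] /= ->; rewrite e22 ramp1 ramp_half; lra.
have pt : rpath p s = edgept d0 d1 (val e) (oval t) by rewrite edgept_inr.
have tN : (oval t < 2^-1) = false by apply/negbTE; rewrite -leNgt ltW.
(* The first quarter follows [p] up to time [s]: closing up gives it half of the time, and
   concatenation halves this again. Then [m] moves the edge parameter from [oval t] to [z.2] at time
   1/2, and on to 1. *)
apply: (pi_class_eqR (H := fun z : R * R =>
  if z.1 <= 4^-1 then rpath p (4 * z.1 * s) else edgept d0 d1 (val e) (m z))).
- apply: continuous_glue => //.
  + apply: rpath_cont; apply: continuous_mulR; last exact: continuous_cst.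
    exact: continuous_compose (@cmul 4).
  + by apply: edgept_continuous => //; exact: continuous_cst.
  + move=> [r w] /= ->; rewrite /m /= ifT; last by lra.
    have -> : 2 * 4^-1 = 2^-1 :> R by lra.
    by rewrite ramp_half mul0r addr0 -pt; congr rpath; lra.
- move=> r r01; rewrite /= [RHS]/rpath cE concatE projI_val //.
  have [/= r4|r4] := leP r 4^-1.
    rewrite ifT; last by lra.
    rewrite /rpath qE projI_val; last by apply/andP; split; lra.
    by rewrite /closed_up ifT /rpath; [congr (pval p (projI _)); lra|lra].
  rewrite /m /=; case: ifP => r2.
    rewrite [RHS]/rpath qE projI_val; last by apply/andP; split; lra.
    rewrite /closed_up ifF; last by apply/negbTE; rewrite -ltNge; lra.
    by rewrite ps /=; congr edgept; lra.
  have {}r2 : 2^-1 < r by rewrite ltNge r2.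
  have /andP[r0 r1] := r01.
  rewrite [RHS]/rpath edge_pathE alphaE projI_val; last by apply/andP; split; lra.
  by congr edgept; rewrite rampE; [lra|rewrite r1 ltW].
- move=> r r01; rewrite /= [RHS]/rpath c'E concatE projI_val //.
  have [/= r4|r4] := leP r 4^-1.
    rewrite ifT; last by lra.
    rewrite /rpath q'E projI_val; last by apply/andP; split; lra.
    by rewrite /closed_up ifT /rpath; [congr (pval p (projI _)); lra|lra].
  rewrite /m /=; case: ifP => r2.
    rewrite [RHS]/rpath q'E projI_val; last by apply/andP; split; lra.
    rewrite /closed_up ifF; last by apply/negbTE; rewrite -ltNge; lra.
    by rewrite ps /= tN; congr edgept; lra.
  by rewrite subrr mulr0 addr0 edgept_ge1 // e1 /rpath kE.
- by move=> w _; rewrite /= ifT ?rpath_le0 //; lra.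
- move=> w _; rewrite /= ifF; last by apply/negbTE; rewrite -ltNge; lra.
  rewrite /m /= ifF; last by apply/negbTE; rewrite -ltNge; lra.
  by rewrite ramp1 edgept_ge1 ?e1 //; lra.
Qed.

(** On the first half of an edge both charts contract to the source by the same formula, so the
    closed-up paths coincide; the second half is [closed_up_past_half]. *)
Lemma closed_up_leave_edge s x y z :
  chart (inr (x, y)) (rpath p s) -> chart (inl z) (rpath p s) ->
  closed_up_value s (inl z) =
  ocomp (closed_up_value s (inr (x, y))) (leave_edge f x y z (rpath p s)).
Proof.
move=> hu hz; have [q qE] := closed_up_path hu; have [q' q'E] := closed_up_path hz.
rewrite (closed_up_valueE qE) (closed_up_valueE q'E).
case: (edge_star_cases hu hz) => -[e [t [ps ht ez]]]; subst z.
  rewrite ps leave_edge_lt // oidE ocomp1r; congr (Some (G (pi_class _))).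
  apply: pval_inj => w; rewrite qE q'E /closed_up ps /=.
  by rewrite ht.
rewrite ps leave_edge_gt // oidE ocomp1r /=; congr Some.
exact: closed_up_past_half ps ht qE q'E.
Qed.

Lemma closed_up_lift :
  is_lift (o := fun K => f0 (chart_base K)) chart (transition f) (rpath p)
    closed_up_value 0 1.
Proof.
move=> s _; split.
- move=> K Ks; have [q qE] := closed_up_path Ks.
  by rewrite (closed_up_valueE qE); eexists.
- case=> [x|[x y]] [x'|[x' y']] hK hM; rewrite /transition.
  + by move: (star_unique hK hM) => ?; subst; rewrite oidE ocomp1r.
  (* Entering the edge chart is the inverse of leaving it, so the two transitions cancel. *)
  + rewrite (closed_up_leave_edge hM hK) -ocompA.
    have [c ->] := leave_edge_some f hM hK.
    by rewrite /= tg_inv_r ocomp1r.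
  + exact: closed_up_leave_edge.
  + by move: (edge_unique hK hM) => -[? ?]; subst; rewrite oidE ocomp1r.
- by move=> K Ks; apply: filterS (closed_up_value_near Ks) => s' ->.
Qed.

(** The lift [closed_up_value] starts at a constant path, hence at the identity, and ends at [p]
    followed by a constant path, hence at [G [p]]. *)
Lemma path_value_functor : path_value f p (G (pi_class p)).
Proof.
exists closed_up_value; split; first exact: closed_up_lift.
- have [k kE] := @const_path R V E d0 d1 x0.
  rewrite (@closed_up_valueE 0 (inl x0) k); first by rewrite pi_class_const.
  move=> t; rewrite kE /closed_up; case: ifP => _.
    by rewrite mulr0 rpath_le0.
  by rewrite rpath_le0.
- have [k kE] := @const_path R V E d0 d1 y0.
  have [c cE] := concat_path p k.
  rewrite (@closed_up_valueE 1 (inl y0) c).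
    by rewrite (pi_comp_class cE) (pi_class_const kE) tg_id_r.
  move=> t; rewrite cE concatE /closed_up; case: ifP => _; first by rewrite mulr1.
  by rewrite /rpath kE -/(rpath p 1) rpath_ge1.
Qed.

End Uniqueness.

(* A Top-graph Gamma: discrete vertex set V, edge space E, continuous
   d0, d1 : E -> V (continuity into the discrete space V = open fibres).
   Conclusion: pi^tau(Gamma, Gamma_0) together with the map
   [e] |-> [alpha_e] from pi_0(Gamma) is a free Top-groupoid on pi_0(Gamma),
   i.e. pi^tau(Gamma,Gamma_0) ~= F(pi_0(Gamma)) via the map induced by
   [e] |-> [alpha_e]. *)
Theorem theorem4p8 (R : realType) (V : Type) (E : topologicalType)
  (d0 d1 : E -> V)
  (hd0 : forall v : V, open (d0 @^-1` [set v]))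
  (hd1 : forall v : V, open (d1 @^-1` [set v])) :
  pi_tau_free_on_pi0 R d0 d1.
Proof.
split=> [x y W|H f0 f f_cont]; first exact: tau_open_pi0.
exists (class_value f); split.
- exact: class_value_functor.
- exact: class_value_tau.
- exact: class_value_factors.
(* For any competing [G], the arrow [G [p]] is a path value of [p], and path values are unique. *)
move=> G G_functor _ G_factors x y a.
have [p ->] := pi_class_surj a.
apply: path_value_unique (path_value_functor hd0 hd1 G_functor G_factors p) _.
exact: class_valueP (sval_pi_class p).
Qed.
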